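(* Let $\varphi\in C(S^{4n-1})$. The Dirichlet problem $$\triangle u=0\ \text{ on } B^{4n},\qquad u=\varphi\ \text{ on } S^{4n-1},$$ has a unique solution $u$ in $C^2(B^{4n})\cap C(\overline{B^{4n}})$, which is given on $B^{4n}$ by the $\mathcal{QM}$-Poisson integral $$P[\varphi](\mathbf{a})=\int_{S^{4n-1}}P(\mathbf{a},\zeta)\varphi(\zeta)\,d\sigma(\zeta),\qquad P(\mathbf{a},\zeta)=\left(\frac{1-|\mathbf{a}|^2}{|1-\mathbf{a}^*\zeta|^2}\right)^{2n+1}\quad(\mathbf{a}\in B^{4n},\ \zeta\in S^{4n-1}).$$
   Context: $\mathbb{H}$ is the quaternion algebra, $n\ge1$, $\mathbb{H}^n$ is the space of quaternionic $(n\times1)$ column vectors, $\mathbf{a}^*=\bar{\mathbf{a}}^t$, $|\mathbf{q}|^2=\mathbf{q}^*\mathbf{q}$, $B^{4n}=\{\mathbf{q}\in\mathbb{H}^n:|\mathbf{q}|<1\}$, $S^{4n-1}=\partial B^{4n}$. $\sigma$ is the ${\rm Sp}(n){\rm Sp}(1)$-invariant (rotation-invariant) measure on $S^{4n-1}$ with $\sigma(S^{4n-1})=1$. For $\mathbf{a}\in B^{4n}$ put $s_{\mathbf{a}}=(1-|\mathbf{a}|^2)^{1/2}$, $\mathbf{A}=(1-s_{\mathbf{a}})|\mathbf{a}|^{-2}\mathbf{a}\mathbf{a}^*+s_{\mathbf{a}}I_n$ (with $\mathbf{A}=I_n$ if $\mathbf{a}=\mathbf{0}$), and $\varphi_{\mathbf{a}}(\mathbf{q})=(\mathbf{a}-\mathbf{A}\mathbf{q})(1-\mathbf{a}^*\mathbf{q})^{-1}$.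 The $\mathcal{QM}$-invariant Laplacian is $(\triangle f)(\mathbf{a})=\triangle_0(f\circ\varphi_{\mathbf{a}})(\mathbf{0})$ for $f\in C^2(B^{4n})$, where $\triangle_0$ is the Euclidean Laplacian on $\mathbb{R}^{4n}\cong\mathbb{H}^n$. *)

(* Defs.v *)
From HB Require Import structures.
From mathcomp Require Import all_boot all_order all_algebra.
From mathcomp Require Import ring.
From mathcomp Require Import all_classical all_reals all_analysis.

Set Implicit Arguments.
Unset Strict Implicit.
Unset Printing Implicit Defensive.

Import Order.TTheory GRing.Theory Num.Theory.
Import numFieldNormedType.Exports.

Local Open Scope classical_set_scope.
Local Open Scope ring_scope.

Record quat (R : Type) : Type := Quat { qre : R; qim_i : R; qim_j : R; qim_k : R }.

Section QuatEncoding.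
Variable R : Type.

Definition prod_of_quat (x : quat R) := (qre x, qim_i x, qim_j x, qim_k x).
Definition quat_of_prod (x : R * R * R * R) :=
  let: (a, b, c, d) := x in Quat a b c d.

Lemma prod_of_quatK : cancel prod_of_quat quat_of_prod.
Proof. by case. Qed.

End QuatEncoding.

HB.instance Definition _ (R : choiceType) :=
  Choice.copy (quat R) (can_type (@prod_of_quatK R)).

Section QuatRing.
Variable R : realType.
Implicit Types x y z : quat R.

Definition qadd x y :=
  let: Quat a b c d := x in let: Quat a' b' c' d' := y in
  Quat (a + a') (b + b') (c + c') (d + d').

Definition qopp x := let: Quat a b c d := x in Quat (- a) (- b) (- c) (- d).

Definition qmul x y :=
  let: Quat a b c d := x in let: Quat a' b' c' d' := y in
  Quat (a * a' - b * b' - c * c' - d * d')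
       (a * b' + b * a' + c * d' - d * c')
       (a * c' - b * d' + c * a' + d * b')
       (a * d' + b * c' - c * b' + d * a').

Definition qreal (r : R) : quat R := Quat r 0 0 0.

Lemma qaddA : associative qadd.
Proof. by move=> [????] [????] [????]; rewrite /= !addrA. Qed.
Lemma qaddC : commutative qadd.
Proof. by move=> [????] [????]; congr Quat; apply: addrC. Qed.
Lemma qadd0 : left_id (qreal 0) qadd.
Proof. by move=> [????]; rewrite /= !add0r. Qed.
Lemma qaddN : left_inverse (qreal 0) qopp qadd.
Proof. by move=> [????]; rewrite /= !addNr. Qed.

HB.instance Definition _ :=
  GRing.isZmodule.Build (quat R) qaddA qaddC qadd0 qaddN.

Lemma qmulA : associative qmul.
Proof. by move=> [????] [????] [????]; congr Quat; ring. Qed.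
Lemma qmul1 : left_id (qreal 1) qmul.
Proof. by move=> [????]; congr Quat; ring. Qed.
Lemma qmulr1 : right_id (qreal 1) qmul.
Proof. by move=> [????]; congr Quat; ring. Qed.
Lemma qmulDl : left_distributive qmul qadd.
Proof. by move=> [????] [????] [????]; congr Quat; ring. Qed.
Lemma qmulDr : right_distributive qmul qadd.
Proof. by move=> [????] [????] [????]; congr Quat; ring. Qed.
Lemma q1_neq0 : qreal 1 != 0.
Proof. by apply/eqP => -[] /eqP; rewrite oner_eq0. Qed.

HB.instance Definition _ := GRing.Zmodule_isNzRing.Build (quat R)
  qmulA qmul1 qmulr1 qmulDl qmulDr q1_neq0.

Definition qconj x := let: Quat a b c d := x in Quat a (- b) (- c) (- d).

Definition qnormsq x := qre x ^+ 2 + qim_i x ^+ 2 + qim_j x ^+ 2 + qim_k x ^+ 2.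

Lemma qconj_mul x : qconj x * x = qreal (qnormsq x).
Proof. by case: x => a b c d; rewrite /qnormsq /=; congr Quat; ring. Qed.

Lemma mul_qconj x : x * qconj x = qreal (qnormsq x).
Proof. by case: x => a b c d; rewrite /qnormsq /=; congr Quat; ring. Qed.

Lemma qreal_comm (r : R) x : qreal r * x = x * qreal r.
Proof. by case: x => a b c d; congr Quat; ring. Qed.

Lemma qrealM (r s : R) : qreal r * qreal s = qreal (r * s).
Proof. by congr Quat; ring. Qed.

Lemma qnormsq_eq0 x : (qnormsq x == 0) = (x == 0).
Proof.
case: x => a b c d; rewrite /qnormsq /=.
rewrite !paddr_eq0 ?addr_ge0 ?sqr_ge0 // !sqrf_eq0.
apply/idP/eqP => [/andP[/andP[/andP[]]]|[-> -> -> ->]]; last by rewrite !eqxx.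
by do 4![move=> /eqP ->].
Qed.

Definition qunit : {pred quat R} := fun x => x != 0.
Definition qinv x : quat R := qreal (qnormsq x)^-1 * qconj x.

Lemma qmulVx : {in qunit, left_inverse 1 qinv *%R}.
Proof.
move=> x x0; rewrite /qinv -mulrA qconj_mul qrealM mulVf //.
by rewrite qnormsq_eq0.
Qed.
Lemma qmulxV : {in qunit, right_inverse 1 qinv *%R}.
Proof.
move=> x x0; rewrite /qinv mulrA -qreal_comm -mulrA mul_qconj qrealM mulVf //.
by rewrite qnormsq_eq0.
Qed.
Lemma qunitP x y : y * x = 1 /\ x * y = 1 -> qunit x.
Proof.
by move=> [yx _]; apply/eqP => x0; move: yx; rewrite x0 mulr0 => /eqP;
  rewrite eq_sym oner_eq0.
Qed.
Lemma qinv_out : {in [predC qunit], qinv =1 id}.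
Proof.
move=> x; rewrite inE /= => /negPn/eqP ->; rewrite /qinv.
by rewrite (_ : qconj 0 = 0) ?mulr0 //; congr Quat; rewrite oppr0.
Qed.

HB.instance Definition _ := GRing.NzRing_hasMulInverse.Build (quat R)
  qmulVx qmulxV qunitP qinv_out.

End QuatRing.

Section QuaternionicVectors.
Variable R : realType.
Local Notation H := (quat R).

Definition adjmx (m n : nat) (M : 'M[H]_(m, n)) : 'M[H]_(n, m) :=
  (map_mx (@qconj R) M)^T.

Definition hdot (n : nat) (a q : 'cV[H]_n) : H := (adjmx a *m q) 0 0.

(* q^* q is a real quaternion, see hdotqq below. *)
Definition hnormsq (n : nat) (q : 'cV[H]_n) : R := qre (hdot q q).

Definition hnorm (n : nat) (q : 'cV[H]_n) : R := Num.sqrt (hnormsq q).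

Lemma hdotqq (n : nat) (q : 'cV[H]_n) :
  hdot q q = qreal (\sum_i qnormsq (q i 0)).
Proof.
rewrite /hdot mxE.
elim/big_ind2: _ => // [x r y s -> ->|i _].
  by rewrite /GRing.add /= !addr0.
by rewrite !mxE qconj_mul.
Qed.

Lemma hnormsqE (n : nat) (q : 'cV[H]_n) :
  hnormsq q = \sum_i qnormsq (q i 0).
Proof. by rewrite /hnormsq hdotqq. Qed.

Definition mobius_s (n : nat) (a : 'cV[H]_n) : R := Num.sqrt (1 - hnormsq a).

Definition mobius_mx (n : nat) (a : 'cV[H]_n) : 'M[H]_n :=
  if a == 0 then 1%:M else
  qreal ((1 - mobius_s a) / hnormsq a) *: (a *m adjmx a)
  + qreal (mobius_s a) *: 1%:M.

(* The product with the 1 x 1 matrix c%:M multiplies every entry by c on the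
   right. *)
Definition mobius (n : nat) (a q : 'cV[H]_n) : 'cV[H]_n :=
  (a - mobius_mx a *m q) *m ((1 - hdot a q)^-1)%:M.

Definition poisson_kernel (n : nat) (a zeta : 'cV[H]_n) : R :=
  ((1 - hnormsq a) / qnormsq (1 - hdot a zeta)) ^+ (2 * n).+1.

End QuaternionicVectors.

(* H^n is identified with R^{4n}, presented as n x 4 real matrices whose i-th
   row lists the real coordinates of the i-th quaternion.  Topology,
   derivatives and Borel sets are those of this real space. *)
Notation realHn R n := ('M[R]_(n, 4)).

Section RealCoordinates.
Variables (R : realType) (n : nat).

Definition hcol (x : realHn R n) : 'cV[quat R]_n :=
  \col_i Quat (x i (inord 0)) (x i (inord 1)) (x i (inord 2)) (x i (inord 3)).

Definition rcoord (v : 'cV[quat R]_n) : realHn R n :=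
  \matrix_(i, k) nth 0
    [:: qre (v i 0); qim_i (v i 0); qim_j (v i 0); qim_k (v i 0)] k.

Lemma hcolK : cancel hcol rcoord.
Proof.
move=> x; apply/matrixP => i k; rewrite !mxE /=.
have -> : k = inord (val k) by rewrite inord_val.
by case: k => -[|[|[|[|]]]] //= lt_k; rewrite inordK.
Qed.

Lemma rcoordK : cancel rcoord hcol.
Proof.
move=> v; apply/matrixP => i j; rewrite !mxE !inordK //= ord1.
by case: (v i 0).
Qed.

Definition qball : set (realHn R n) := [set x | hnorm (hcol x) < 1].

Definition qsphere : set (realHn R n) := closure qball `\` interior qball.

End RealCoordinates.

Arguments qball : clear implicits.
Arguments qsphere : clear implicits.

Section Laplacian.
Variables (R : realType) (n : nat).
Local Notation V := (realHn R n).

Definition partial (i : 'I_n) (k : 'I_4) (f : V -> R) : V -> R :=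
  fun x => 'D_(delta_mx i k) f x.

(* C^k on an open set U, for a function whose values outside U are
   irrelevant. *)
Fixpoint is_Ck (k : nat) (U : set V) (f : V -> R) : Prop :=
  (forall x, U x -> {for x, continuous f}) /\
  (if k is k'.+1 then
     forall i j, (forall x, U x -> derivable f x (delta_mx i j))
                 /\ is_Ck k' U (partial i j f)
   else True).

Definition laplacian0 (f : V -> R) (x : V) : R :=
  \sum_(i < n) \sum_(k < 4) partial i k (partial i k f) x.

Definition invariant_laplacian (f : V -> R) (a : V) : R :=
  laplacian0 (fun q => f (rcoord (mobius (hcol a) (hcol q)))) 0.

Definition dirichlet_solution (phi u : V -> R) : Prop :=
  [/\ is_Ck 2 (qball R n) u,
      {within closure (qball R n), continuous u},
      forall a, qball R n a -> invariant_laplacian u a = 0 &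
      forall zeta, qsphere R n zeta -> u zeta = phi zeta].

End Laplacian.

Section SphereMeasure.
Variables (R : realType) (n : nat).

Definition borelHn := g_sigma_algebraType (@open (realHn R n)).

Definition spsp1_act (U : 'M[quat R]_n) (p : quat R) (x : realHn R n) :
    realHn R n :=
  rcoord (U *m hcol x *m p%:M).

Definition spsp1_invariant (sigma : set borelHn -> \bar R) : Prop :=
  forall (U : 'M[quat R]_n) (p : quat R),
    adjmx U *m U = 1%:M -> qnormsq p = 1 ->
  forall A : set borelHn, measurable A ->
    sigma (spsp1_act U p @^-1` A) = sigma A.

(* A Borel probability on the closed set S^{4n-1} is the same thing as a Borel
   probability on H^n giving mass 1 to S^{4n-1}. *)
Definition is_sphere_measure (sigma : probability borelHn R) : Prop :=
  sigma (qsphere R n) = 1%E /\ spsp1_invariant sigma.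

Definition poisson_integral (sigma : probability borelHn R)
    (phi : realHn R n -> R) (a : realHn R n) : R :=
  \int[sigma]_(zeta in (qsphere R n : set borelHn))
    (poisson_kernel (hcol a) (hcol zeta) * phi zeta).

End SphereMeasure.

(* Main.v *)
(* Put eta = phi_a(zeta).  The identities for 1 - |phi_a(q)|^2 and
   1 - phi_a(q)^* zeta give P(phi_a(q), zeta) = P(a, zeta) P(q, eta), and an
   explicit computation along the coordinate axes gives
     Delta_0 ((1 - |q|^2) / |1 - q^* eta|^2)^m (0) = 4m(m-1)|eta|^2 - 8mn,
   which is 0 for |eta| = 1 and m = 2n+1: Poisson integrals are harmonic.
   With m = 1 and eta = a it gives Delta |x|^2 (a) = 8n(1 - |a|^2) > 0, so a
   perturbation by |x|^2 yields the maximum principle on every ball |x| <= r,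
   r <= 1, hence uniqueness.  The integral of P(a, .) is Sp(n)Sp(1)-invariant in
   a, so it is constant on spheres, therefore (uniqueness on smaller balls)
   constant, with value 1 at the origin; the boundary values then follow from
   |1 - a^* zeta| >= |a - zeta|^2 / 2. *)

Require Import Defs.
From HB Require Import structures.
From mathcomp Require Import all_boot all_order all_algebra.
From mathcomp Require Import ring lra.
From mathcomp Require Import all_classical all_reals all_analysis.

Set Implicit Arguments.
Unset Strict Implicit.
Unset Printing Implicit Defensive.

Import Order.TTheory GRing.Theory Num.Theory.
Import numFieldNormedType.Exports.

Local Open Scope classical_set_scope.
Local Open Scope ring_scope.

(** The Laplacians that matter are evaluated at the origin, after composition with phi_a. No
    derivative of the kernel at a general point has to be computed: along a coordinate axis through
    0 both 1 - |x|^2 and |1 - x^* eta|^2 are quadratic polynomials in one variable. For a Poisson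
    integral the composition is absorbed by the factorization of the kernel: the result is again an
    integral of kernels, with density P(a, zeta) phi(zeta) and eta in place of zeta, so sigma is
    never transported by phi_a. A competing solution f has no formula, and there the composition is
    the obstacle: C^2 is stated through partial derivatives, so a chain rule is derived from the
    continuity of the partials, to ensure that f o phi_a has the second derivatives that its
    Laplacian adds up. Differentiation under the integral is treated once, for a class of kernels
    closed under differentiation. *)

Section QuaternionAlgebra.
Variable R : realType.
Local Notation H := (quat R).
Implicit Types x y : H.

(** * Conjugation, norm and real part of quaternions *)

Lemma qreD x y : qre (x + y) = qre x + qre y.
Proof. by case: x; case: y. Qed.

Lemma qreN x : qre (- x) = - qre x.
Proof. by case: x. Qed.

Lemma qconjD x y : qconj (x + y) = qconj x + qconj y.
Proof. by case: x => ????; case: y => ????; congr Quat; rewrite opprD. Qed.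

Lemma qconjN x : qconj (- x) = - qconj x.
Proof. by case: x. Qed.

Lemma qconjM x y : qconj (x * y) = qconj y * qconj x.
Proof. by case: x => ????; case: y => ????; congr Quat; ring. Qed.

Lemma qconjK x : qconj (qconj x) = x.
Proof. by case: x => ????; congr Quat; rewrite opprK. Qed.

Lemma qconj_real (r : R) : qconj (qreal r) = qreal r.
Proof. by congr Quat; rewrite oppr0. Qed.

Lemma qconj1 : qconj (1 : H) = 1.
Proof. exact: qconj_real. Qed.

Lemma qconj0 : qconj (0 : H) = 0.
Proof. exact: qconj_real. Qed.

Lemma qnormsqM x y : qnormsq (x * y) = qnormsq x * qnormsq y.
Proof. by case: x => ????; case: y => ????; rewrite /qnormsq /=; ring. Qed.

Lemma qnormsq_conj x : qnormsq (qconj x) = qnormsq x.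
Proof. by case: x => ????; rewrite /qnormsq /=; ring. Qed.

Lemma qnormsq_ge0 x : 0 <= qnormsq x.
Proof. by rewrite /qnormsq !addr_ge0 ?sqr_ge0. Qed.

Lemma qnormsq1 : qnormsq (1 : H) = 1.
Proof. by rewrite /qnormsq /=; ring. Qed.

Lemma qnormsqV x : x != 0 -> qnormsq x^-1 = (qnormsq x)^-1.
Proof.
move=> x0; have nx0 : qnormsq x != 0 by rewrite qnormsq_eq0.
by apply: (mulfI nx0); rewrite -qnormsqM mulrV ?qnormsq1 ?divff.
Qed.

Lemma qre_sqr_le x : qre x ^+ 2 <= qnormsq x.
Proof. by rewrite /qnormsq -!addrA lerDl !addr_ge0 ?sqr_ge0. Qed.

Lemma qnormsq_1B x : qnormsq (1 - x) = 1 - 2 * qre x + qnormsq x.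
Proof. by case: x => ????; rewrite /qnormsq /=; ring. Qed.

Lemma qreal1 : qreal 1 = 1 :> H. Proof. by []. Qed.

Lemma qrealD (r s : R) : qreal (r + s) = qreal r + qreal s.
Proof. by congr Quat; rewrite addr0. Qed.

Lemma qrealN (r : R) : qreal (- r) = - qreal r.
Proof. by congr Quat; rewrite oppr0. Qed.

(** * Adjoint matrices and the Hermitian product on H^n *)

Lemma adjmxD m n (A B : 'M[H]_(m, n)) : adjmx (A + B) = adjmx A + adjmx B.
Proof. by apply/matrixP => i j; rewrite !mxE qconjD. Qed.

Lemma adjmxN m n (A : 'M[H]_(m, n)) : adjmx (- A) = - adjmx A.
Proof. by apply/matrixP => i j; rewrite !mxE qconjN. Qed.

Lemma qconj_sum (I : Type) (r : seq I) (F : I -> H) :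
  qconj (\sum_(i <- r) F i) = \sum_(i <- r) qconj (F i).
Proof. by elim/big_rec2: _ => [|i y z _ <-]; rewrite ?qconj0 ?qconjD. Qed.

Lemma adjmxM m n p (A : 'M[H]_(m, n)) (B : 'M[H]_(n, p)) :
  adjmx (A *m B) = adjmx B *m adjmx A.
Proof.
apply/matrixP => i j; rewrite !mxE qconj_sum; apply: eq_bigr => k _.
by rewrite !mxE qconjM.
Qed.

Lemma adjmxK m n (A : 'M[H]_(m, n)) : adjmx (adjmx A) = A.
Proof. by apply/matrixP => i j; rewrite !mxE qconjK. Qed.

Lemma adjmxZ m n (r : R) (A : 'M[H]_(m, n)) :
  adjmx (qreal r *: A) = qreal r *: adjmx A.
Proof. by apply/matrixP => i j; rewrite !mxE qconjM qconj_real qreal_comm. Qed.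

Lemma adjmx_scalar n (c : H) : adjmx (c%:M : 'M[H]_n) = (qconj c)%:M.
Proof. by apply/matrixP => i j; rewrite !mxE eq_sym; case: eqP;
  rewrite ?qconj0. Qed.

(** Scalars act on the left of the entries; a real one is central and can therefore be moved past
    [A]. *)
Lemma mulmx_real m n p (r : R) (A : 'M[H]_(m, n)) (B : 'M[H]_(n, p)) :
  A *m (qreal r *: B) = qreal r *: (A *m B).
Proof.
apply/matrixP => i j; rewrite !mxE mulr_sumr; apply: eq_bigr => k _.
by rewrite !mxE !mulrA qreal_comm.
Qed.

Lemma hdotE n (a q : 'cV[H]_n) : adjmx a *m q = (hdot a q)%:M.
Proof. exact: mx11_scalar. Qed.

Lemma hdot_conj n (a q : 'cV[H]_n) : qconj (hdot a q) = hdot q a.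
Proof. by rewrite /hdot -{2}(adjmxK a) -adjmxM !mxE. Qed.

Lemma hdotBr n (a q q' : 'cV[H]_n) : hdot a (q - q') = hdot a q - hdot a q'.
Proof. by rewrite /hdot mulmxBr !mxE. Qed.

Lemma hdotBl n (a a' q : 'cV[H]_n) : hdot (a - a') q = hdot a q - hdot a' q.
Proof. by rewrite /hdot adjmxD adjmxN mulmxBl !mxE. Qed.

Lemma hdotMr n (a q : 'cV[H]_n) (c : H) : hdot a (q *m c%:M) = hdot a q * c.
Proof. by rewrite /hdot mulmxA hdotE -scalar_mxM !mxE eqxx !mulr1n. Qed.

Lemma hdotMl n (a q : 'cV[H]_n) (c : H) :
  hdot (a *m c%:M) q = qconj c * hdot a q.
Proof. by rewrite -hdot_conj hdotMr qconjM hdot_conj. Qed.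

Lemma hdot_mx n (A : 'M[H]_n) (a q : 'cV[H]_n) :
  hdot (A *m a) q = hdot a (adjmx A *m q).
Proof. by rewrite /hdot adjmxM mulmxA. Qed.

Lemma hdot_norm n (a : 'cV[H]_n) : hdot a a = qreal (hnormsq a).
Proof. by rewrite hnormsqE hdotqq. Qed.

Lemma hnormsq_ge0 n (a : 'cV[H]_n) : 0 <= hnormsq a.
Proof. by rewrite hnormsqE sumr_ge0 // => i _; exact: qnormsq_ge0. Qed.

Lemma hnormsq0 n : hnormsq (0 : 'cV[H]_n) = 0.
Proof. by rewrite /hnormsq /hdot mulmx0 mxE. Qed.

Lemma hnormsq_eq0 n (a : 'cV[H]_n) : (hnormsq a == 0) = (a == 0).
Proof.
apply/idP/eqP => [|->]; last by rewrite hnormsq0.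
rewrite hnormsqE psumr_eq0 => [/allP h|i _]; last exact: qnormsq_ge0.
apply/matrixP => i j; rewrite ord1 mxE; apply/eqP; rewrite -qnormsq_eq0.
by have := h i (mem_index_enum _).
Qed.

Lemma hnorm_lt1 n (a : 'cV[H]_n) : (hnorm a < 1) = (hnormsq a < 1).
Proof. by rewrite /hnorm -{1}sqrtr1 ltr_sqrt. Qed.

Lemma hnormsqB n (a q : 'cV[H]_n) :
  hnormsq (a - q) = hnormsq a + hnormsq q - 2 * qre (hdot a q).
Proof.
rewrite {1}/hnormsq hdotBr !hdotBl !(qreD, qreN) !hdot_norm /=.
by rewrite -(hdot_conj a q); case: (hdot a q) => ???? /=; ring.
Qed.

Lemma hnormsqM n (a : 'cV[H]_n) (c : H) :
  hnormsq (a *m c%:M) = hnormsq a * qnormsq c.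
Proof.
rewrite {1}/hnormsq hdotMr hdotMl hdot_norm -qreal_comm -mulrA qconj_mul.
by rewrite qrealM.
Qed.

(** Polarization. On the ball every summand is nonnegative, which makes the denominators of phi_a
    and of the kernel nonzero and bounds them from below. *)
Lemma qre_1Bhdot n (a q : 'cV[H]_n) : qre (1 - hdot a q) =
  (hnormsq (a - q) + (1 - hnormsq a) + (1 - hnormsq q)) / 2.
Proof. by rewrite qreD qreN /= hnormsqB; field. Qed.

Lemma hdot_lt1 n (a q : 'cV[H]_n) :
  hnormsq a < 1 -> hnormsq q <= 1 -> 1 - hdot a q != 0.
Proof.
move=> a1 q1; apply/eqP => e0.
have := qre_1Bhdot a q; rewrite e0 /=; have := hnormsq_ge0 (a - q); lra.
Qed.

(** Since |w|^2 >= (Re w)^2, it suffices to drop the two nonnegative terms 1 - |a|^2 and 1 - |q|^2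
    in [qre_1Bhdot]. *)
Lemma qnormsq_1Bhdot_ge n (a q : 'cV[H]_n) :
  hnormsq a <= 1 -> hnormsq q <= 1 ->
  hnormsq (a - q) ^+ 2 / 4 <= qnormsq (1 - hdot a q).
Proof.
move=> a1 q1; apply: le_trans (qre_sqr_le _); rewrite qre_1Bhdot expr_div_n.
rewrite (_ : 2 ^+ 2 = 4 :> R); last by ring.
rewrite ler_pM2r ?invr_gt0 ?ltr0n //.
have := hnormsq_ge0 (a - q) => d0.
by apply: lerXn2r; rewrite ?nnegrE //; lra.
Qed.

Lemma qnormsq_hdotC n (a q : 'cV[H]_n) :
  qnormsq (1 - hdot a q) = qnormsq (1 - hdot q a).
Proof. by rewrite -(hdot_conj q a) -qnormsq_conj qconjD qconjN qconj1 qconjK.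
  Qed.

Lemma poisson_kernel_ge0 n (a z : 'cV[H]_n) :
  hnormsq a <= 1 -> 0 <= poisson_kernel a z.
Proof. by move=> ?; rewrite exprn_ge0 // divr_ge0 ?qnormsq_ge0 // subr_ge0. Qed.

(** * Norm identities for phi_a and the factorization of the kernel *)

Section Mobius.
Variables (n : nat) (a : 'cV[H]_n).
Hypothesis a1 : hnormsq a < 1.
Local Notation A := (mobius_mx a).
Local Notation s := (mobius_s a).

Lemma mobius_s_sqr : s ^+ 2 = 1 - hnormsq a.
Proof. by rewrite sqr_sqrtr // subr_ge0 ltW. Qed.

Lemma mobius_mx_adj : adjmx A = A.
Proof.
rewrite /mobius_mx; case: ifP => _; first by rewrite adjmx_scalar qconj1.
by rewrite adjmxD !adjmxZ adjmxM adjmxK adjmx_scalar qconj1.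
Qed.

Lemma mobius_mx_self : A *m a = a.
Proof.
rewrite /mobius_mx; case: ifPn => [_|a0]; first by rewrite mul1mx.
rewrite mulmxDl -!scalemxAl mul1mx -mulmxA hdotE hdot_norm.
rewrite -(scalemx1 _ (qreal _)) mulmx_real mulmx1 scalerA qrealM -scalerDl.
by rewrite -qrealD divfK ?hnormsq_eq0 // subrK scale1r.
Qed.

(** [mobius_mx a] fixes a and is multiplication by s on its orthogonal complement. The square is
    thus s^2 on the complement and 1 = |a|^2 + s^2 on a. *)
Lemma mobius_mx_sqr : A *m A = a *m adjmx a + qreal (s ^+ 2) *: 1%:M.
Proof.
rewrite {2}/mobius_mx; case: ifPn => [/eqP ->|a0].
  rewrite mul0mx add0r mulmx1 /mobius_mx eqxx /mobius_s hnormsq0 subr0.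
  by rewrite sqrtr1 expr1n scale1r.
rewrite mulmxDr !mulmx_real mulmx1 mulmxA mobius_mx_self /mobius_mx (negbTE a0).
rewrite scalerDr !scalerA !qrealM addrA -scalerDl -qrealD -expr2.
congr (_ + _); rewrite -[RHS]scale1r -qreal1; congr (qreal _ *: _).
have n0 : hnormsq a != 0 by rewrite hnormsq_eq0.
have := mobius_s_sqr; rewrite expr2 => es.
transitivity ((1 - s * s) / hnormsq a); first by field.
by rewrite es; field.
Qed.

(** Expand |a - Aq|^2 with a^* A q = a^* q and, from the formula for A^2, |Aq|^2 = |a^* q|^2 + (1 -
    |a|^2)|q|^2; then subtract from |1 - a^* q|^2. *)
Lemma hnormsq_mobius q : 1 - hdot a q != 0 ->
  1 - hnormsq (mobius a q) =
  (1 - hnormsq a) * (1 - hnormsq q) / qnormsq (1 - hdot a q).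
Proof.
move=> e0; rewrite /mobius hnormsqM qnormsqV //.
have n0 : qnormsq (1 - hdot a q) != 0 by rewrite qnormsq_eq0.
apply: (mulIf n0); rewrite mulrBl mul1r !divfK //.
rewrite hnormsqB.
have -> : hdot a (A *m q) = hdot a q.
  by rewrite -{1}mobius_mx_adj -hdot_mx mobius_mx_self.
have -> : hnormsq (A *m q) = qnormsq (hdot a q)
   + (1 - hnormsq a) * hnormsq q.
  rewrite {1}/hnormsq hdot_mx mobius_mx_adj mulmxA mobius_mx_sqr mobius_s_sqr.
  rewrite mulmxDl -mulmxA hdotE -scalemxAl mul1mx.
  rewrite {1}/hdot mulmxDr mulmx_real mulmxA (hdotE q a) (hdotE q q)
    -scalar_mxM.
  rewrite !mxE !eqxx !mulr1n qreD -(hdot_conj a q) qconj_mul /=.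
  by rewrite hdot_norm qrealM.
by rewrite qnormsq_1B; ring.
Qed.

Lemma mobius_open q : hnormsq q < 1 -> hnormsq (mobius a q) < 1.
Proof.
move=> q1; have e0 := hdot_lt1 a1 (ltW q1).
rewrite -subr_gt0 hnormsq_mobius // divr_gt0 ?mulr_gt0 ?subr_gt0 //.
by rewrite lt_neqAle qnormsq_ge0 eq_sym qnormsq_eq0 e0.
Qed.

Lemma mobius_sphere q : hnormsq q = 1 -> hnormsq (mobius a q) = 1.
Proof.
move=> q1; have q1' : hnormsq q <= 1 by rewrite q1.
by have := hnormsq_mobius (hdot_lt1 a1 q1'); rewrite q1 subrr mulr0 mul0r; lra.
Qed.

Lemma mobius0 : mobius a 0 = a.
Proof. by rewrite /mobius mulmx0 subr0 /hdot mulmx0 mxE subr0 invr1 mulmx1. Qed.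

(* The factorization behind this identity of norms is
   1 - phi_a(q)^* z = (1 - q^* a)^-1 (1 - q^* phi_a(z)) (1 - a^* z). *)
Lemma hdot_mobius q z : 1 - hdot a q != 0 -> 1 - hdot a z != 0 ->
  qnormsq (1 - hdot (mobius a q) z) * qnormsq (1 - hdot a q) =
  qnormsq (1 - hdot q (mobius a z)) * qnormsq (1 - hdot a z).
Proof.
move=> q0 z0.
(* Conjugated and moved to the left, this factor meets the inverse inside [hdot (mobius a q) z]; the
   two sides then agree as quaternions and not only in norm. *)
rewrite -(qnormsq_conj (1 - hdot a q)) [LHS]mulrC -!qnormsqM; congr qnormsq.
rewrite qconjD qconj1 qconjN hdot_conj mulrBr mulr1 [RHS]mulrBl mul1r.
rewrite /mobius hdotMl hdotMr -[in RHS]mulrA mulVr // mulr1.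
have -> : qconj (1 - hdot a q)^-1 = (1 - hdot q a)^-1.
  have e : 1 - hdot q a = qconj (1 - hdot a q).
    by rewrite qconjD qconj1 qconjN hdot_conj.
  have u : 1 - hdot q a \is a GRing.unit.
    by apply/negP => /eqP; rewrite e => /(congr1 (@qconj R));
      rewrite qconjK qconj0 => /eqP; exact/negP.
  apply: (mulrI u); rewrite mulrV // e -qconjM mulVr ?qconj1 //.
rewrite mulrA mulrV ?mul1r; last first.
  apply/negP => /eqP h; move: q0 => /negP; apply.
  by rewrite -(qconjK (1 - hdot a q)) qconjD qconj1 qconjN hdot_conj h qconj0.
rewrite hdotBl hdotBr hdot_mx mobius_mx_adj !opprB.
by rewrite addrACA [RHS]addrACA; congr (_ + _); rewrite addrC.
Qed.

Lemma poisson_kernel_mobius q z : hnormsq q < 1 -> hnormsq z = 1 ->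
  poisson_kernel (mobius a q) z =
  poisson_kernel a z * poisson_kernel q (mobius a z).
Proof.
move=> q1 z1; have q0 := hdot_lt1 a1 (ltW q1).
have z0 : 1 - hdot a z != 0 by rewrite hdot_lt1 // z1.
have Mz : 1 - hdot q (mobius a z) != 0.
  by rewrite hdot_lt1 // mobius_sphere.
have Mq : 1 - hdot (mobius a q) z != 0 by rewrite hdot_lt1 ?mobius_open // z1.
rewrite /poisson_kernel -exprMn; congr (_ ^+ _); rewrite hnormsq_mobius //.
have := hdot_mobius q0 z0.
rewrite -!qnormsq_eq0 in q0 z0 Mz Mq.
by rewrite mulrC => e; rewrite -[LHS]mulrA -invfM e mulrC mulf_div [in
  LHS]mulrC [in LHS](mulrC (qnormsq _)).
Qed.

End Mobius.

(** The reflection 1 - 2 w w^* / |w|^2 with w = a - b. As a^* b is real and |a| = |b|, one has w^* a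
    = |w|^2 / 2, so a goes to a - w = b. *)
Lemma householder n (a b : 'cV[H]_n) (r : R) :
  hnormsq a = hnormsq b -> hdot a b = qreal r ->
  exists2 U : 'M[H]_n, adjmx U *m U = 1%:M & U *m a = b.
Proof.
move=> ab dr; case: (eqVneq a b) => [<-|neq].
  by exists 1%:M; rewrite ?mul1mx // adjmx_scalar qconj1 mul1mx.
have [w wE] : exists w, w = a - b by exists (a - b).
pose k := 2 / hnormsq w.
have w0 : hnormsq w != 0 by rewrite wE hnormsq_eq0 subr_eq0.
have ww : hnormsq w = 2 * (hnormsq a - r).
  by rewrite wE hnormsqB -ab dr /=; ring.
have U2 : adjmx (1%:M - qreal k *: (w *m adjmx w)) = 1%:M - qreal k *: (w *m
  adjmx w).
  by rewrite adjmxD adjmxN adjmxZ adjmxM adjmxK adjmx_scalar qconj1.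
exists (1%:M - qreal k *: (w *m adjmx w)).
  rewrite U2 mulmxBr mulmx1 mulmx_real mulmxBl mul1mx -scalemxAl.
  rewrite -mulmxA (mulmxA (adjmx w)) hdotE hdot_norm mul_scalar_mx mulmx_real.
  rewrite scalerBr !scalerA !qrealM opprB.
  have -> : k * k * hnormsq w = k + k by rewrite /k; field.
  by rewrite qrealD scalerDl addrK subrK.
rewrite mulmxBl mul1mx -scalemxAl -mulmxA hdotE {2}wE hdotBl hdot_norm.
rewrite -(hdot_conj a b) dr qconj_real -qrealN -qrealD.
rewrite -scalemx1 mulmx_real mulmx1 scalerA qrealM.
have -> : k * (hnormsq a - r) = 1.
  rewrite (_ : hnormsq a - r = hnormsq w / 2); last by rewrite ww; field.
  by rewrite /k; field.
by rewrite scale1r wE opprB addrC subrK.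
Qed.

(* Multiplying a on the right by a suitable unit quaternion makes a^* b real,
   and then a Householder reflection exchanges the two vectors. *)
Lemma sphere_transitive n (a b : 'cV[H]_n) : hnormsq a = hnormsq b ->
  exists (U : 'M[H]_n) (p : H),
    [/\ adjmx U *m U = 1%:M, qnormsq p = 1 & U *m a *m p%:M = b].
Proof.
move=> ab.
have [p [r [p1 pr]]] : exists p r, qnormsq p = 1 /\ qconj p * hdot a b = qreal
  r.
  have [d0|d0] := eqVneq (hdot a b) 0.
    by exists 1, 0; rewrite qnormsq1 d0 mulr0.
  have n0 : 0 < qnormsq (hdot a b).
    by rewrite lt_neqAle qnormsq_ge0 eq_sym qnormsq_eq0 d0.
  exists (qreal (Num.sqrt (qnormsq (hdot a b)))^-1 * hdot a b).
  eexists; split; last first.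
    by rewrite qconjM qconj_real -qreal_comm -mulrA qconj_mul qrealM.
  rewrite qnormsqM (_ : qnormsq (qreal _) = (qnormsq (hdot a b))^-1).
    by rewrite mulVf ?gt_eqF.
  rewrite /qnormsq /= !expr0n /= !addr0 exprVn sqr_sqrtr // ltW //.
have abp : hnormsq (a *m p%:M) = hnormsq b by rewrite hnormsqM p1 mulr1.
have := pr; rewrite -hdotMl => /(householder abp)[U U1 Uab].
by exists U, p; split => //; rewrite -mulmxA.
Qed.

Lemma hdot_spsp1 n (U : 'M[H]_n) (p : H) (a z : 'cV[H]_n) :
  adjmx U *m U = 1%:M ->
  hdot (U *m a *m p%:M) (U *m z *m p%:M) = qconj p * hdot a z * p.
Proof. by move=> U1; rewrite hdotMr hdotMl hdot_mx mulmxA U1 mul1mx. Qed.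

Lemma hnormsq_spsp1 n (U : 'M[H]_n) (p : H) (a : 'cV[H]_n) :
  adjmx U *m U = 1%:M -> qnormsq p = 1 -> hnormsq (U *m a *m p%:M) = hnormsq a.
Proof.
move=> U1 p1; rewrite {1}/hnormsq hdot_spsp1 // hdot_norm -qreal_comm -mulrA.
by rewrite qconj_mul qrealM p1 mulr1.
Qed.

Lemma poisson_kernel_spsp1 n (U : 'M[H]_n) (p : H) (a z : 'cV[H]_n) :
  adjmx U *m U = 1%:M -> qnormsq p = 1 ->
  poisson_kernel (U *m a *m p%:M) (U *m z *m p%:M) = poisson_kernel a z.
Proof.
move=> U1 p1; rewrite /poisson_kernel hnormsq_spsp1 // hdot_spsp1 //.
have -> : 1 - qconj p * hdot a z * p = qconj p * (1 - hdot a z) * p.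
  by rewrite mulrBr mulrBl mulr1 qconj_mul p1.
by rewrite !qnormsqM qnormsq_conj p1 mul1r mulr1.
Qed.

End QuaternionAlgebra.

(** * Balls and spheres in the real coordinates *)

Section RealCoordinateTopology.
Variables (R : realType) (n : nat).
Local Notation V := (realHn R n).
Implicit Types x y : V.

Local Notation Q x := (hnormsq (hcol (x : V))).

Lemma sum_ord4 (F : 'I_4 -> R) :
  \sum_k F k = F (inord 0) + F (inord 1) + F (inord 2) + F (inord 3).
Proof.
rewrite !big_ord_recr big_ord0 /= add0r.
by congr (_ + _ + _ + _); congr F; apply: val_inj; rewrite /= inordK.
Qed.

Lemma hnormsq_hcol x : Q x = \sum_i \sum_k x i k ^+ 2.
Proof.
rewrite hnormsqE; apply: eq_bigr => i _.
by rewrite sum_ord4 /qnormsq !mxE.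
Qed.

Lemma hcolD x y : hcol (x + y) = hcol x + hcol y.
Proof. by apply/matrixP => i j; rewrite !mxE. Qed.

Lemma hcolN x : hcol (- x) = - hcol x.
Proof. by apply/matrixP => i j; rewrite !mxE. Qed.

Lemma hcolB x y : hcol (x - y) = hcol x - hcol y.
Proof. by rewrite hcolD hcolN. Qed.

Lemma hcol0 : hcol (0 : V) = 0.
Proof. by apply/matrixP => i j; rewrite !mxE. Qed.

Lemma coord_sqr_le x i k : x i k ^+ 2 <= Q x.
Proof.
rewrite hnormsq_hcol (bigD1 i) //= (bigD1 k) //= -addrA lerDl.
by rewrite addr_ge0 ?sumr_ge0 // => *; rewrite ?sumr_ge0 // => *;
  rewrite sqr_ge0.
Qed.

Lemma hnormsq_hcolZ (t : R) x : Q (t *: x) = t ^+ 2 * Q x.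
Proof.
rewrite !hnormsq_hcol mulr_sumr; apply: eq_bigr => i _.
by rewrite mulr_sumr; apply: eq_bigr => k _; rewrite mxE exprMn.
Qed.

Lemma mx_norm_le p q (M : 'M[R]_(p, q)) e : 0 <= e ->
  (forall i k, `|M i k| <= e) -> `|M| <= e.
Proof.
move=> e0 Me; rewrite [leLHS]/Num.norm /= mx_normrE.
by apply: bigmax_le => // -[i k] _; exact: Me.
Qed.

Lemma coord_le_mx_norm p q (M : 'M[R]_(p, q)) i k : `|M i k| <= `|M|.
Proof.
rewrite [leRHS]/Num.norm /= mx_normrE.
exact: (le_bigmax _ (fun i : 'I_p * 'I_q => `|M i.1 i.2|) (i, k)).
Qed.

Lemma cvg_mx T (F : set_system T) {FF : Filter F} p q (f : T -> 'M[R]_(p, q))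
    (M : 'M[R]_(p, q)) :
  (forall i k, f t i k @[t --> F] --> M i k) -> f @ F --> M.
Proof.
move=> fM; apply/cvgrPdist_le => /= e e0; near=> t.
apply: mx_norm_le (ltW e0) _ => i k; rewrite !mxE.
move: i k; near: t; apply: filter_forall => i; apply: filter_forall => k.
exact: (cvgrPdist_le _ _).1 (fM i k) _ e0.
Unshelve. all: by end_near. Qed.

Lemma hnormsq_hcol_le x (e : R) : 0 <= e -> Q x <= e ^+ 2 -> `|x| <= e.
Proof.
move=> e0 xe; apply: mx_norm_le => // i k.
rewrite -ler_sqr ?nnegrE // real_normK ?num_real //.
exact: le_trans (coord_sqr_le _ _ _) xe.
Qed.

Lemma hnormsq_hcol_continuous : continuous (fun x => Q x).
Proof.
under eq_fun do rewrite hnormsq_hcol.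
apply: (continuous_big (x0 := 0)) => [|i _]; first exact: add_continuous.
apply: (continuous_big (x0 := 0)) => [|k _ x]; first exact: add_continuous.
have c := @coord_continuous R n 4 i k x; exact: (cvgM c c).
Qed.

Lemma closed_hnormsq_le r : closed [set x | Q x <= r].
Proof.
rewrite (_ : [set _ | _] = (fun x => Q x) @^-1` [set y | y <= r]) //.
by apply: closed_comp; [move=> x _; exact: hnormsq_hcol_continuous|exact:
  closed_le].
Qed.

Lemma open_hnormsq_lt r : open [set x | Q x < r].
Proof.
rewrite (_ : [set _ | _] = (fun x => Q x) @^-1` [set y | y < r]) //.
by apply: open_comp; [move=> x _; exact: hnormsq_hcol_continuous|exact:
  open_lt].
Qed.

(** [bounded_closed_compact] speaks of row vectors, so the ball is the image under [vec_mx] of a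
    closed bounded set of rows. *)
Lemma compact_hnormsq_le r : compact [set x | Q x <= r].
Proof.
pose B := [set v : 'rV[R]_(n * 4) | Q (vec_mx v) <= r].
have cv : continuous (fun v : 'rV[R]_(n * 4) => vec_mx v : V).
  move=> v; apply: (@cvg_mx _ (nbhs v) _) => i k; rewrite mxE.
  under eq_fun do rewrite mxE; exact: coord_continuous.
have -> : [set x | Q x <= r] = vec_mx @` B.
  apply/seteqP; split => [x xr|_ [v vr <-]] //.
  by exists (mxvec x); rewrite /B /= mxvecK.
apply: continuous_compact; first exact: continuous_subspaceT.
apply: bounded_closed_compact.
  (* The bound 1 gives r <= M <= M^2, as r bounds a squared norm and M a norm. *)
  exists (Num.max r 1); split => [|M rM v /= vr]; first exact: num_real.
  move: rM; rewrite gt_max => /andP[rM M1].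
  have M0 : 0 <= M by rewrite ltW // (lt_trans _ M1).
  apply: mx_norm_le => // i k; rewrite ord1 -[v]vec_mxK.
  case/mxvec_indexP: k => i' k'; rewrite mxvecE.
  rewrite -ler_sqr ?nnegrE // real_normK ?num_real //.
  apply: le_trans (coord_sqr_le _ _ _) _; apply: le_trans vr _.
  by rewrite (le_trans (ltW rM)) // expr2 ler_peMl // ltW.
rewrite (_ : B = (fun v => vec_mx v : V) @^-1` [set x | Q x <= r]) //.
by apply: closed_comp; [move=> x _; exact: cv|exact: closed_hnormsq_le].
Qed.

Lemma qballE : qball R n = [set x | Q x < 1].
Proof. by apply/seteqP; split => x; rewrite /qball /= hnorm_lt1. Qed.

Lemma open_qball : open (qball R n).
Proof. by rewrite qballE; exact: open_hnormsq_lt. Qed.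

Lemma closure_qball : closure (qball R n) = [set x | Q x <= 1].
Proof.
rewrite qballE; apply/seteqP; split.
  rewrite [X in _ `<=` X](closure_id _).1; last exact: closed_hnormsq_le.
  by apply: closure_subset => x /= /ltW.
move=> x /= x1 B Bx.
have cx : (fun t : R => t *: x) @ (1 : R) --> (1 : R) *: x by apply:
  scalel_continuous.
have : \forall t \near (1 : R), B (t *: x) by apply: cx; rewrite scale1r.
move=> /nbhs_ballP[e /= e0 eB].
(* Radial contraction: t x lies in the open ball for 0 <= t < 1, and t is within e of 1. The maximum
   with 0 covers large e. *)
pose t := Num.max 0 (1 - e / 2).
have t0 : 0 <= t by rewrite le_max lexx.
have t1 : t < 1 by rewrite gt_max ltr01 /= ltrBlDr ltrDl divr_gt0.
exists (t *: x); split.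
  rewrite /= hnormsq_hcolZ (@le_lt_trans _ _ (t ^+ 2 * 1)) //.
    by rewrite ler_wpM2l ?sqr_ge0.
  by rewrite mulr1 expr_lt1.
apply: eB; rewrite /ball /= ger0_norm ?subr_ge0 ?ltW //.
have : 1 - e / 2 <= t by rewrite le_max lexx orbT.
by lra.
Qed.

Lemma interior_qball : interior (qball R n) = qball R n.
Proof. by apply/interior_id; exact: open_qball. Qed.

Lemma qsphereE : qsphere R n = [set x | Q x = 1].
Proof.
rewrite /qsphere closure_qball interior_qball qballE.
apply/seteqP; split => x /=.
  by move=> [x1 /negP]; rewrite -leNgt => x1'; apply/eqP; rewrite eq_le x1.
by move=> ->; rewrite lexx ltxx.
Qed.

Lemma compact_qsphere : compact (qsphere R n).
Proof.
apply: (subclosed_compact _ (@compact_hnormsq_le 1)).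
  rewrite /qsphere setDE; apply: closedI; first exact: closed_closure.
  by apply: open_closedC; exact: open_interior.
by rewrite qsphereE => x /= ->.
Qed.

End RealCoordinateTopology.

(** * Directional derivatives as derivatives along a line *)

Section Derivatives.
Variables (R : realType) (V : normedModType R).
Implicit Types (f g : V -> R) (x v : V).

(** The two difference quotients are the same function of h; this reduces directional derivatives to
    one-variable calculus. *)
Lemma derive_lineE f x v (t : R) :
  (fun h => h^-1 *: ((f \o shift (x + t *: v)) (h *: v) - f (x + t *: v))) =
  (fun h => h^-1 *: (((fun s : R => f (x + s *: v)) \o shift t) (h *: 1) - f (x
    + t *: v))).
Proof.
apply/funext => h /=; congr (_ *: (f _ - _)).
by rewrite /shift /= scalerDl addrCA; congr (_ + (_ *: _ + _));
  rewrite /GRing.scale /= mulr1.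
Qed.

Lemma derivable_line f x v (t : R) :
  derivable f (x + t *: v) v <-> derivable (fun s : R => f (x + s *: v)) t 1.
Proof. by rewrite /derivable derive_lineE. Qed.

Lemma derive_line f x v (t : R) :
  'D_v f (x + t *: v) = 'D_1 (fun s : R => f (x + s *: v)) t.
Proof. by rewrite /derive derive_lineE. Qed.

Lemma is_derive_line f x v (t df : R) :
  is_derive (x + t *: v) v f df <-> is_derive t 1 (fun s : R =>
    f (x + s *: v)) df.
Proof.
split=> -[fv fE].
  by apply: DeriveDef; [exact/derivable_line|rewrite -derive_line].
by apply: DeriveDef; [exact/derivable_line|rewrite derive_line].
Qed.

Lemma is_derive_line0 f x v (df : R) :
  is_derive x v f df <-> is_derive (0 : R) 1 (fun s : R => f (x + s *: v)) df.
Proof. by rewrite -is_derive_line scale0r addr0. Qed.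

End Derivatives.

(** * Kernels rational in x with continuous coefficients in z *)

Section SmoothKernel.
Variables (R : realType) (n : nat) (Z : topologicalType).
Local Notation V := (realHn R n).
Variables (U : set V) (S : set Z).

(* Functions of (x, z) that are rational in the coordinates of x, with
   coefficients continuous in the parameter z.  The class is closed under
   partial derivatives in x, so its members are smooth in x. *)
Inductive smooth_kernel : (V -> Z -> R) -> Prop :=
| sk_param g : {within S, continuous g} -> smooth_kernel (fun _ z => g z)
| sk_coord i k : smooth_kernel (fun x _ => x i k)
| sk_add K L : smooth_kernel K -> smooth_kernel L ->
    smooth_kernel (fun x z => K x z + L x z)
| sk_mul K L : smooth_kernel K -> smooth_kernel L ->
    smooth_kernel (fun x z => K x z * L x z)
| sk_inv K : smooth_kernel K -> (forall x z, U x -> S z -> K x z != 0) ->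
    smooth_kernel (fun x z => (K x z)^-1).

Lemma sk_cst c : smooth_kernel (fun _ _ => c).
Proof. by apply: sk_param; apply/continuous_subspaceT => z; exact: cvg_cst. Qed.

Lemma sk_opp K : smooth_kernel K -> smooth_kernel (fun x z => - K x z).
Proof.
move=> sK; have := sk_mul (sk_cst (-1)) sK; congr smooth_kernel.
by apply/funext => x; apply/funext => z; rewrite mulN1r.
Qed.

Lemma sk_sub K L : smooth_kernel K -> smooth_kernel L ->
  smooth_kernel (fun x z => K x z - L x z).
Proof. by move=> sK sL; apply: sk_add => //; exact: sk_opp. Qed.

Lemma sk_exp K m : smooth_kernel K -> smooth_kernel (fun x z => K x z ^+ m).
Proof.
move=> sK; elim: m => [|m IHm].
  by under eq_fun => x do under eq_fun do rewrite expr0; exact: sk_cst.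
by under eq_fun => x do under eq_fun do rewrite exprS; exact: sk_mul.
Qed.

Lemma sk_sum (I : Type) (r : seq I) (F : I -> V -> Z -> R) :
  (forall i, smooth_kernel (F i)) ->
  smooth_kernel (fun x z => \sum_(i <- r) F i x z).
Proof.
move=> sF; elim: r => [|i r IHr].
  by under eq_fun => x do under eq_fun do rewrite big_nil; exact: sk_cst.
by under eq_fun => x do under eq_fun do rewrite big_cons; exact: sk_add.
Qed.

(** The derivative is built inside the class, so the statement can be iterated to any order. The
    nonvanishing stored in [sk_inv] is what the quotient rule needs. *)
Lemma sk_derive K v : smooth_kernel K ->
  exists2 dK, smooth_kernel dK &
    forall x z, U x -> S z -> is_derive x v (K ^~ z) (dK x z).
Proof.
elim=> {K} [g gS|i k|K L _ [dK sdK KdK] _ [dL sdL LdL]|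
            K L sK [dK sdK KdK] sL [dL sdL LdL]|K sK [dK sdK KdK] K0].
- by exists (fun _ _ => 0); [exact: sk_cst|move=> x z _ _;
  exact: is_derive_cst].
- exists (fun _ _ => v i k); first exact: sk_cst.
  move=> x z _ _; apply: DeriveDef.
    by have /derivable_mxP := @derivable_id _ V x v; exact.
  have := derive_mx (@derivable_id _ V x v); rewrite derive_id.
  by move=> /matrixP/(_ i k); rewrite mxE.
- exists (fun x z => dK x z + dL x z); first exact: sk_add.
  by move=> x z Ux Sz; apply: is_deriveD; [exact: KdK|exact: LdL].
- exists (fun x z => K x z *: dL x z + L x z *: dK x z).
    by apply: sk_add; exact: sk_mul.
  by move=> x z Ux Sz; apply: is_deriveM; [exact: KdK|exact: LdL].
- exists (fun x z => - (K x z)^-1 ^+ 2 *: dK x z).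
    by apply: sk_mul => //; apply: sk_opp; apply: sk_exp; exact: sk_inv.
  move=> x z Ux Sz; have [dvK vE] := KdK _ _ Ux Sz; have Kxz := K0 _ _ Ux Sz.
  by apply: DeriveDef; [exact: derivableV|rewrite deriveV // vE exprVn].
Qed.

(** Joint continuity in (x, z), with z approaching z0 within S because the coefficients are
    continuous only relative to S. *)
Lemma sk_cvg K x0 z0 : smooth_kernel K -> U x0 -> S z0 ->
  K p.1 p.2 @[p --> filter_prod (nbhs x0) (within S (nbhs z0))] --> K x0 z0.
Proof.
move=> sK Ux0 Sz0; elim: sK => {K} [g gS|i k|K L _ Kc _ Lc|K L _ Kc _ Lc|K _ Kc
  K0].
- have /subspace_continuousP/(_ _ Sz0) gz0 := gS.
  by apply: cvg_comp gz0; exact: cvg_snd.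
- have c := @coord_continuous R n 4 i k x0.
  exact: (@cvg_comp _ _ _ fst (fun M : V => M i k) _ (nbhs x0) _ cvg_fst c).
- exact: cvgD.
- exact: cvgM.
- by apply: cvgV => //; exact: K0.
Qed.

Lemma sk_continuous_param K x0 : smooth_kernel K -> U x0 ->
  {within S, continuous (K x0)}.
Proof.
move=> sK Ux0; elim: sK => {K} [g gS|i k|K L _ Kc _ Lc|K L _ Kc _ Lc|K _ Kc K0]
  //.
- by apply/continuous_subspaceT => z; exact: cvg_cst.
- by move=> z; apply: cvgD; [exact: Kc|exact: Lc].
- by move=> z; apply: cvgM; [exact: Kc|exact: Lc].
- apply/subspace_continuousP => z Sz; apply: cvgV; first exact: K0.
  by move/subspace_continuousP : Kc; exact.
Qed.

(** Compactness of S in covering form: near each z0 both K x z and K x0 z are within e/2 of K x0 z0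
    by [sk_cvg]. *)
Lemma sk_unif K x0 (e : R) : compact S -> smooth_kernel K -> U x0 -> 0 < e ->
  \forall x \near x0, forall z, S z -> `|K x z - K x0 z| <= e.
Proof.
move=> cS sK Ux0 e0.
move/compact_near_coveringP/near_covering_withinP : cS => cS.
apply: (cS _ (nbhs x0) (fun x z => `|K x z - K x0 z| <= e)) => z0 Sz0.
have /cvgrPdist_le/(_ (e / 2)) := sk_cvg sK Ux0 Sz0.
rewrite divr_gt0 // => /(_ isT)[[A B]] /= [Ax0 Bz0] AB.
exists ([set z | S z -> B z], A) => [|[z x] /= [Bz Ax] Sz]; first by split.
have := AB (x, z); have := AB (x0, z); rewrite /=.
have Ax00 : A x0 by exact: nbhs_singleton.
move=> /(_ (conj Ax00 (Bz Sz))) h1 /(_ (conj Ax (Bz Sz))) h2.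
rewrite (splitr e); apply: le_trans (ler_distD (K x0 z0) _ _) _.
by rewrite lerD // distrC.
Qed.

End SmoothKernel.

(** * Integrating kernels over a compact set: continuity and differentiation *)

Section SphereIntegral.
Variables (R : realType) (n : nat).
Local Notation V := (realHn R n).
Variable sigma : probability (borelHn R n) R.
Variable S : set V.
Hypothesis compS : compact S.

Lemma open_borelHn (A : set V) : open A -> measurable (A : set (borelHn R n)).
Proof. by move=> oA; exact: sub_gen_smallest. Qed.

Lemma compact_borelHn : measurable (S : set (borelHn R n)).
Proof.
rewrite -(setCK S); apply: measurableC; apply: open_borelHn.
by apply: closed_openC; exact: compact_closed.
Qed.

Lemma continuous_borelHn (f : V -> R) : {within S, continuous f} ->
  measurable_fun (S : set (borelHn R n)) (f : borelHn R n -> R).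
Proof.
move=> /continuousP cf.
apply: (measurability _ (measurable_realfun.RGenOpens.measurableE R)).
move=> _ [_ [a [b ->]] <-].
have /cf/open_subspaceP[W oW WS] : open `]a, b[%classic by exact: interval_open.
rewrite setIC -WS; apply: measurableI; last exact: compact_borelHn.
exact: open_borelHn.
Qed.

Lemma integrable_continuous (f : V -> R) : {within S, continuous f} ->
  sigma.-integrable (S : set (borelHn R n)) (EFin \o (f : borelHn R n -> R)).
Proof.
move=> cf; apply: measurable_bounded_integrable.
- exact: compact_borelHn.
- by rewrite (le_lt_trans (probability_le1 _ _)) ?ltry //;
  exact: compact_borelHn.
- exact: continuous_borelHn.
- have /compact_bounded[M [_ mrt]] := continuous_compact cf compS.
  by exists M; split; rewrite ?num_real // => ? ? ? ?; exact: mrt.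
Qed.

Local Notation "'\I' f" := (\int[sigma]_(z in (S : set (borelHn R n))) (f z))
  (at level 10).

Lemma sphere_integral_le (f : V -> R) (e : R) : {within S, continuous f} ->
  0 <= e -> (forall z, S z -> `|f z| <= e) -> `|\I f| <= e.
Proof.
move=> cf e0 fe; have mS := compact_borelHn.
apply: le_trans (le_normr_Rintegral mS (integrable_continuous cf)) _.
have ie : sigma.-integrable (S : set (borelHn R n)) (EFin \o (fun _ => e)).
  by apply: integrable_continuous; apply/continuous_subspaceT;
    exact: cst_continuous.
apply: le_trans (@le_Rintegral _ _ _ sigma S _ (fun _ => e) mS _ ie _) _ => //.
  by move/integrable_norm: (integrable_continuous cf).
rewrite Rintegral_cst //.
have : fine (sigma S) <= 1.
  by rewrite -[1]/(fine 1%E) fine_le // ?probability_le1 // fin_num_measure.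
by move=> s1; rewrite -[leRHS]mulr1 ler_wpM2l.
Qed.

Variable U : set V.
Hypothesis openU : open U.
Local Notation smooth_kernel := (smooth_kernel U S).

Definition kernel_integral (K : V -> V -> R) (x : V) : R := \I (K x).

Lemma kernel_integral_continuous K x0 : smooth_kernel K -> U x0 ->
  {for x0, continuous (kernel_integral K)}.
Proof.
move=> sK Ux0.
apply/(@cvgrPdist_le _ _ _ _ (nbhs_filter x0)) => e e0.
have nU : \forall x \near x0, U x by exact: open_nbhs_nbhs.
near=> x.
have Ux : U x by near: x.
have mS := compact_borelHn.
have cK y : U y -> {within S, continuous (K y)} by move=> Uy;
  exact: sk_continuous_param sK Uy.
rewrite /kernel_integral -(RintegralB mS (integrable_continuous (cK _ Ux0))
  (integrable_continuous (cK _ Ux))).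
apply: sphere_integral_le (ltW e0) _.
  by move=> z; apply: cvgB; [exact: (cK _ Ux0)|exact: (cK _ Ux)].
move=> z; rewrite distrC; move: z; near: x.
exact: (sk_unif compS sK Ux0 e0).
Unshelve. all: by end_near. Qed.

(** Differentiation under the integral for the one-variable functions t -> K (x0 + t v) z, dominated
    by a constant that is uniform in z by compactness. *)
Lemma kernel_integral_derive K dK v x0 : smooth_kernel K -> smooth_kernel dK ->
  (forall x z, U x -> S z -> is_derive x v (K ^~ z) (dK x z)) -> U x0 ->
  is_derive x0 v (kernel_integral K) (kernel_integral dK x0).
Proof.
move=> sK sdK KdK Ux0.
(* |M| + 1 bounds [dK x0] on S by compactness; [sk_unif] with tolerance 1 costs one more unit for
   nearby x. *)
have [M M0 dKM] : exists2 M : R, 0 <= M & \forall x \near x0, forall z,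
  S z -> `|dK x z| <= M.
  have /compact_bounded[M [_ mrt]] := continuous_compact (sk_continuous_param
    sdK Ux0) compS.
  exists (`|M| + 2); first by rewrite addr_ge0.
  near=> x => z Sz.
  have h1 : `|dK x z - dK x0 z| <= 1.
    by move: z Sz; near: x; exact: (sk_unif compS sdK Ux0 ltr01).
  have h2 : `|dK x0 z| <= `|M| + 1.
    by apply: mrt; [rewrite (le_lt_trans (ler_norm M)) // ltrDl|exists z].
  rewrite -(subrK (dK x0 z) (dK x z)); apply: le_trans (ler_normD _ _) _.
  by rewrite (_ : 2 = 1 + 1) // addrCA lerD.
have [d d0 dP] : exists2 d : R, 0 < d & forall t : R, `|t| < d ->
    U (x0 + t *: v) /\ forall z, S z -> `|dK (x0 + t *: v) z| <= M.
  have ct : (x0 + t *: v) @[t --> (0 : R)] --> x0.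
    rewrite -[X in _ --> X]addr0 -(scale0r v).
    by apply: cvgD; [exact: cvg_cst|exact: scalel_continuous].
  have nU : \forall x \near x0, U x by exact: open_nbhs_nbhs.
  have : \forall t \near (0 : R),
      U (x0 + t *: v) /\ forall z, S z -> `|dK (x0 + t *: v) z| <= M.
    exact: ct _ (filterI nU dKM).
  move=> /nbhs_ballP[d /= d0 dP].
  by exists d => // t td; apply: dP; rewrite /ball /= sub0r normrN.
rewrite -[x0]addr0 -(scale0r v); apply/is_derive_line.
rewrite scale0r addr0.
have I0 : `]-d, d[%classic (0 : R) by rewrite /= in_itv /= oppr_lt0 d0.
have Id t : `]-d, d[%classic t -> `|t| < d by rewrite /= in_itv /= ltr_norml.
have Kd t z : `]-d, d[%classic t -> S z ->
    is_derive t 1 (fun s : R => K (x0 + s *: v) z) (dK (x0 + t *: v) z).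
  by move=> /Id/dP[Ut _] Sz; apply/(is_derive_line (K ^~ z)); exact: KdK.
have mS := compact_borelHn.
have := @cvg_differentiation_under_integral R _ _ sigma
  (fun t z => K (x0 + t *: v) z) S mS 0 (-d) d I0 _ _ (fun _ => M) (fun _ =>
    M0) _ _.
have -> : \I (partial1of2 (fun t z => K (x0 + t *: v) z) 0) = kernel_integral
  dK x0.
  apply: eq_Rintegral => z; rewrite inE => Sz.
  rewrite partial1of2E.
  by have [_ ->] := Kd _ _ I0 Sz; rewrite scale0r addr0.
move=> h.
have {}h : h^-1 *: (kernel_integral K (x0 + (h + 0) *: v) - kernel_integral K
  (x0 + 0 *: v)) @[h --> 0^'] --> kernel_integral dK x0.
  apply: h.
  - by move=> t /Id/dP[Ut _]; apply: integrable_continuous;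
    exact: sk_continuous_param sK Ut.
  - by move=> t z It Sz; have [] := Kd _ _ It Sz.
  - by apply: integrable_continuous; apply/continuous_subspaceT;
    exact: cst_continuous.
  - move=> t z It Sz; rewrite partial1of2E; have [_ ->] := Kd _ _ It Sz.
    by have [_] := dP _ (Id _ It); exact.
have {}h : h^-1 *: (((fun s : R => kernel_integral K (x0 + s *: v)) \o shift 0)
  (h *: 1) - kernel_integral K (x0 + 0 *: v)) @[h --> 0^']
    --> kernel_integral dK x0.
  by under eq_fun => t do rewrite /= /GRing.scale /= mulr1.
apply: DeriveDef; first by apply/cvg_ex; exists (kernel_integral dK x0).
exact/cvg_lim.
Unshelve. all: by end_near. Qed.

End SphereIntegral.

(** * C^k regularity of kernels and of their integrals *)

Section SmoothFunctions.
Variables (R : realType) (n : nat).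
Local Notation V := (realHn R n).

Lemma near_eq_continuous (f g : V -> R) x : (\forall y \near x, f y = g y) ->
  {for x, continuous f} -> {for x, continuous g}.
Proof.
move=> fg cf; have e : f x = g x := nbhs_singleton fg.
change (g @ x --> g x); rewrite -e.
by apply: cvg_trans cf; exact: (near_eq_cvg fg).
Qed.

(** U is open, so each condition at a point of U depends only on values in U. This is needed because
    derivatives are identified with kernels on U only. *)
Lemma is_Ck_eq k (U : set V) f g : open U -> (forall x, U x -> f x = g x) ->
  is_Ck k U f -> is_Ck k U g.
Proof.
move=> oU; elim: k f g => [|k IHk] f g fg /= [cf df].
all: have nfg x : U x -> \forall y \near x, f y = g y.
all: try by move=> Ux; near=> y; apply: fg; near: y; exact: open_nbhs_nbhs.
all: split; first by move=> x Ux; apply: near_eq_continuous (cf x Ux);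
  exact: nfg.
  by [].
move=> i j; have [dfx Cdf] := df i j.
have ngf x : U x -> \forall y \near x, g y = f y.
  by move=> /nfg; apply: filterS => y.
split; first by move=> x Ux; apply: near_eq_derivable (nfg x Ux) (dfx x Ux).
by apply: IHk Cdf => x Ux; rewrite /partial; apply: near_eq_derive; exact: nfg.
Unshelve. all: by end_near. Qed.

Section Kernels.
Variables (Z : topologicalType) (U : set V) (S : set Z).
Hypothesis openU : open U.

Lemma sk_continuous K x z : smooth_kernel U S K -> U x -> S z ->
  {for x, continuous (K ^~ z)}.
Proof.
move=> sK Ux Sz; elim: sK => {K} [g gS|i k|K L _ Kc _ Lc|K L _ Kc _ Lc|K _ Kc
  K0].
- exact: cst_continuous.
- exact: coord_continuous.
- exact: continuousD.
- exact: continuousM.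
- by apply: continuousV => //; exact: K0.
Qed.

Lemma sk_Ck k K z : smooth_kernel U S K -> S z -> is_Ck k U (K ^~ z).
Proof.
move=> sK Sz; elim: k K sK => [|k IHk] K sK /=.
all: split; [by move=> x Ux; exact: sk_continuous|].
  by [].
move=> i j; have [dK sdK KdK] := sk_derive (delta_mx i j) sK.
split=> [x Ux|]; first by have [] := KdK _ _ Ux Sz.
apply: is_Ck_eq openU _ (IHk _ sdK) => x Ux.
by have [_ <-] := KdK _ _ Ux Sz.
Qed.

End Kernels.

Section Integrals.
Variable sigma : probability (borelHn R n) R.
Variables (U S : set V).
Hypotheses (openU : open U) (compS : compact S).

Lemma kernel_integral_Ck k K : smooth_kernel U S K ->
  is_Ck k U (kernel_integral sigma S K).
Proof.
elim: k K => [|k IHk] K sK /=.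
all: split; [by move=> x Ux; apply: kernel_integral_continuous sK Ux|].
  by [].
move=> i j; have [dK sdK KdK] := sk_derive (delta_mx i j) sK.
have D x (Ux : U x) := kernel_integral_derive sigma compS openU sK sdK KdK Ux.
split=> [x Ux|]; first by have [] := D _ Ux.
by apply: is_Ck_eq openU _ (IHk _ sdK) => x Ux; have [_ <-] := D _ Ux.
Qed.

Lemma kernel_integral_sum (I : Type) (r : seq I) (F : I -> V -> V -> R) x :
  (forall i, smooth_kernel U S (F i)) -> U x ->
  kernel_integral sigma S (fun x z => \sum_(i <- r) F i x z) x =
  \sum_(i <- r) kernel_integral sigma S (F i) x.
Proof.
move=> sF Ux; elim: r => [|i r IHr].
  rewrite big_nil -[RHS](mul0r (fine (sigma S))) -Rintegral_cst.
    by apply: eq_Rintegral => z _; rewrite big_nil.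
  exact: compact_borelHn.
rewrite big_cons -IHr -RintegralD.
- by apply: eq_Rintegral => z _; rewrite big_cons.
- exact: compact_borelHn.
- by apply: integrable_continuous => //; exact: sk_continuous_param (sF i) Ux.
- apply: integrable_continuous => //.
  exact: sk_continuous_param (sk_sum r sF) Ux.
Qed.

Lemma laplacian0_kernel_integral K x : smooth_kernel U S K -> U x ->
  laplacian0 (kernel_integral sigma S K) x =
  kernel_integral sigma S (fun x z => laplacian0 (K ^~ z) x) x.
Proof.
move=> sK Ux.
have nU : \forall y \near x, U y by exact: open_nbhs_nbhs.
(* One kernel per coordinate represents the second partial of K and, after integration, that of the
   integral; the Laplacian then becomes a finite sum of kernel integrals. *)
have /choice[dd ddP] : forall ij : 'I_n * 'I_4, exists dd,
    [/\ smooth_kernel U S dd,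
     partial ij.1 ij.2 (partial ij.1 ij.2 (kernel_integral sigma S K)) x =
       kernel_integral sigma S dd x &
     forall z, S z -> partial ij.1 ij.2 (partial ij.1 ij.2 (K ^~ z)) x = dd x
       z].
  move=> [i j] /=; have [dK sdK KdK] := sk_derive (delta_mx i j) sK.
  have [ddK sddK dKddK] := sk_derive (delta_mx i j) sdK.
  exists ddK; split=> // [|z Sz].
    have [_ <-] := kernel_integral_derive sigma compS openU sdK sddK dKddK Ux.
    apply: near_eq_derive; near=> y.
    have Uy : U y by near: y.
    by have [_ <-] := kernel_integral_derive sigma compS openU sK sdK KdK Uy.
  have [_ <-] := dKddK _ _ Ux Sz.
  apply: near_eq_derive; near=> y.
  have Uy : U y by near: y.
  by have [_ <-] := KdK _ _ Uy Sz.
have sdd i j : smooth_kernel U S (dd (i, j)) by have [] := ddP (i, j).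
transitivity (kernel_integral sigma S
    (fun x z => \sum_(i < n) \sum_(j < 4) dd (i, j) x z) x).
  rewrite kernel_integral_sum //; last by move=> i; exact: sk_sum.
  apply: eq_bigr => i _; rewrite kernel_integral_sum //.
  by apply: eq_bigr => j _; have [] := ddP (i, j).
apply: eq_Rintegral => z; rewrite inE => Sz.
by apply: eq_bigr => i _; apply: eq_bigr => j _; have [_ _ ->] := ddP (i, j).
Unshelve. all: by end_near. Qed.

End Integrals.

(** * Quaternion-valued kernels, phi_a and powers of the Poisson ratio *)

Section QuaternionKernels.
Variables (Z : topologicalType) (U : set V) (S : set Z).
Local Notation H := (quat R).
Local Notation sk := (smooth_kernel U S).

Definition smooth_qkernel (K : V -> Z -> H) : Prop :=
  [/\ sk (fun x z => qre (K x z)), sk (fun x z => qim_i (K x z)),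
      sk (fun x z => qim_j (K x z)) & sk (fun x z => qim_k (K x z))].

Lemma sqk_eq K L : (forall x z, K x z = L x z) -> smooth_qkernel K ->
  smooth_qkernel L.
Proof. by move=> KL; congr smooth_qkernel; apply/funext => x; apply/funext. Qed.

Lemma sqk_quat A B C D : sk A -> sk B -> sk C -> sk D ->
  smooth_qkernel (fun x z => Quat (A x z) (B x z) (C x z) (D x z)).
Proof. by []. Qed.

Lemma sqk_cst c : smooth_qkernel (fun _ _ => c).
Proof. by split; exact: sk_cst. Qed.

Lemma sqk_add K L : smooth_qkernel K -> smooth_qkernel L ->
  smooth_qkernel (fun x z => K x z + L x z).
Proof.
move=> [? ? ? ?] [? ? ? ?].
apply: (@sqk_eq (fun x z => Quat (qre (K x z) + qre (L x z))
  (qim_i (K x z) + qim_i (L x z)) (qim_j (K x z) + qim_j (L x z))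
  (qim_k (K x z) + qim_k (L x z)))).
  by move=> x z; case: (K x z); case: (L x z).
by apply: sqk_quat; exact: sk_add.
Qed.

Lemma sqk_opp K : smooth_qkernel K -> smooth_qkernel (fun x z => - K x z).
Proof.
move=> [? ? ? ?].
apply: (@sqk_eq (fun x z => Quat (- qre (K x z)) (- qim_i (K x z))
  (- qim_j (K x z)) (- qim_k (K x z)))).
  by move=> x z; case: (K x z).
by apply: sqk_quat; exact: sk_opp.
Qed.

Lemma sqk_conj K : smooth_qkernel K -> smooth_qkernel (fun x z =>
  qconj (K x z)).
Proof.
move=> [? ? ? ?].
apply: (@sqk_eq (fun x z => Quat (qre (K x z)) (- qim_i (K x z))
  (- qim_j (K x z)) (- qim_k (K x z)))).
  by move=> x z; case: (K x z).
by apply: sqk_quat => //; exact: sk_opp.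
Qed.

Lemma sqk_mul K L : smooth_qkernel K -> smooth_qkernel L ->
  smooth_qkernel (fun x z => K x z * L x z).
Proof.
move=> [? ? ? ?] [? ? ? ?].
have E x y : x * y = Quat
       (qre x * qre y - qim_i x * qim_i y - qim_j x * qim_j y - qim_k x * qim_k
         y)
       (qre x * qim_i y + qim_i x * qre y + qim_j x * qim_k y - qim_k x * qim_j
         y)
       (qre x * qim_j y - qim_i x * qim_k y + qim_j x * qre y + qim_k x * qim_i
         y)
       (qre x * qim_k y + qim_i x * qim_j y - qim_j x * qim_i y + qim_k x * qre
         y) :> H.
  by case: x; case: y.
apply: (sqk_eq (fun x z => esym (E (K x z) (L x z)))).
by apply: sqk_quat; repeat (apply: sk_sub || apply: sk_add || apply: sk_mul ||
  by []).
Qed.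

Lemma sqk_sum (I : Type) (r : seq I) (F : I -> V -> Z -> H) :
  (forall i, smooth_qkernel (F i)) ->
  smooth_qkernel (fun x z => \sum_(i <- r) F i x z).
Proof.
move=> sF; elim: r => [|i r IHr].
  by apply: (sqk_eq _ (sqk_cst 0)) => x z; rewrite big_nil.
by apply: (sqk_eq _ (sqk_add (sF i) IHr)) => x z; rewrite big_cons.
Qed.

Lemma sk_qnormsq K : smooth_qkernel K -> sk (fun x z => qnormsq (K x z)).
Proof. by move=> [? ? ? ?]; do ![apply: sk_add|exact: sk_exp]. Qed.

(** The inverse is the conjugate divided by the squared norm, so only a real kernel has to be
    inverted. *)
Lemma sqk_inv K : smooth_qkernel K -> (forall x z, U x -> S z -> K x z != 0) ->
  smooth_qkernel (fun x z => (K x z)^-1).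
Proof.
move=> sK K0; apply: (@sqk_eq (fun x z => qreal (qnormsq (K x z))^-1 * qconj (K
  x z))).
  by [].
apply: sqk_mul; last exact: sqk_conj.
apply: sqk_quat; try exact: sk_cst.
apply: sk_inv; first exact: sk_qnormsq.
by move=> x z Ux Sz; rewrite qnormsq_eq0 K0.
Qed.

Lemma sqk_hcol i : smooth_qkernel (fun x _ => hcol x i 0).
Proof.
apply: (@sqk_eq (fun x _ => Quat (x i (inord 0)) (x i (inord 1)) (x i (inord
  2)) (x i (inord 3)))).
  by move=> x z; rewrite mxE.
by apply: sqk_quat; exact: sk_coord.
Qed.

Lemma sqk_hdot (F G : V -> Z -> 'cV[H]_n) :
  (forall i, smooth_qkernel (fun x z => F x z i 0)) ->
  (forall i, smooth_qkernel (fun x z => G x z i 0)) ->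
  smooth_qkernel (fun x z => hdot (F x z) (G x z)).
Proof.
move=> sF sG; apply: (@sqk_eq (fun x z => \sum_i qconj (F x z i 0) * G x z i
  0)).
  by move=> x z; rewrite /hdot mxE; apply: eq_bigr => i _; rewrite !mxE.
by apply: sqk_sum => i; apply: sqk_mul => //; exact: sqk_conj.
Qed.

Lemma sk_hnormsq : sk (fun x _ => hnormsq (hcol x)).
Proof. by have [] := sqk_hdot sqk_hcol sqk_hcol. Qed.

Lemma sqk_mobius (a : 'cV[H]_n) i :
  (forall x, U x -> 1 - hdot a (hcol x) != 0) ->
  smooth_qkernel (fun x _ => mobius a (hcol x) i 0).
Proof.
move=> a0.
apply: (@sqk_eq (fun x _ =>
  (a i 0 - \sum_k mobius_mx a i k * hcol x k 0) * (1 - hdot a (hcol x))^-1)).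
  move=> x z; rewrite /mobius mxE big_ord1 !mxE eqxx mulr1n.
  by congr (_ * _); rewrite [in RHS]mxE.
apply: sqk_mul.
  apply: sqk_add; first exact: sqk_cst.
  apply: sqk_opp; apply: sqk_sum => k.
  by apply: sqk_mul; [exact: sqk_cst|exact: sqk_hcol].
apply: sqk_inv => [|x z Ux _]; last exact: a0.
apply: sqk_add; first exact: sqk_cst.
by apply: sqk_opp; apply: sqk_hdot => k; [exact: sqk_cst|exact: sqk_hcol].
Qed.

(* The Poisson kernel is the exponent m = 2n+1; the exponent m = 1 describes
   1 - |phi_a(q)|^2. *)
Definition poisson_power (m : nat) (a zeta : 'cV[H]_n) : R :=
  ((1 - hnormsq a) / qnormsq (1 - hdot a zeta)) ^+ m.

Lemma sk_poisson_power m (eta : V -> Z -> 'cV[H]_n) :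
  (forall i, smooth_qkernel (fun x z => eta x z i 0)) ->
  (forall x z, U x -> S z -> 1 - hdot (hcol x) (eta x z) != 0) ->
  sk (fun x z => poisson_power m (hcol x) (eta x z)).
Proof.
move=> se e0; apply: sk_exp; apply: sk_mul.
  by apply: sk_sub; [exact: sk_cst|exact: sk_hnormsq].
apply: sk_inv => [|x z Ux Sz]; last by rewrite qnormsq_eq0 e0.
apply: sk_qnormsq; apply: sqk_add; first exact: sqk_cst.
by apply: sqk_opp; apply: sqk_hdot => //; exact: sqk_hcol.
Qed.

End QuaternionKernels.
End SmoothFunctions.

(** * Laplacian at the origin of powers of the Poisson ratio *)

Section LaplacianOfPowers.
Variable R : realType.
Local Notation H := (quat R).

Lemma is_derive_pow (f : R -> R) (t df : R) k : is_derive t (1 : R) f df ->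
  is_derive t (1 : R) (fun s => f s ^+ k) (k%:R * f t ^+ k.-1 * df).
Proof.
move=> h; have -> : (fun s => f s ^+ k) = f ^+ k by apply/funext => s;
  rewrite !fctE.
exact: is_deriveX.
Qed.

Lemma is_derive_sqr (t : R) : is_derive t (1 : R) (fun s : R => s ^+ 2) (2 * t).
Proof.
have h := is_derive_pow 2 (is_derive_id t (1 : R)).
by apply: is_derive_eq h _; rewrite expr1 mulr1.
Qed.

Section Line.
Variables (m : nat) (b c : R).
(** For x = t e on a coordinate axis, [N] is 1 - |x|^2 and [D] is |1 - x^* eta|^2, where b is the
    coordinate of eta along e and c the squared norm of the quaternion entry of eta containing it.
    [r'] is the derivative of N / D. *)
Let N (t : R) : R := 1 - t ^+ 2.
Let D (t : R) : R := 1 - 2 * t * b + t ^+ 2 * c.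
Let N' (t : R) : R := - (2 * t).
Let D' (t : R) : R := - (2 * b) + 2 * t * c.
Let r' (t : R) : R := N' t * (D t)^-1 - N t * (D t)^-1 ^+ 2 * D' t.

Let dN (t : R) : is_derive t (1 : R) N (N' t).
Proof.
have := is_deriveB (is_derive_cst (1 : R) t (1 : R)) (is_derive_sqr t).
by move=> h; apply: is_derive_eq h _; rewrite sub0r.
Qed.

Let dmul (k t : R) : is_derive t (1 : R) (fun s : R => s * k) k.
Proof.
have := is_deriveM (is_derive_id t (1 : R)) (is_derive_cst k t (1 : R)).
by move=> h; apply: is_derive_eq h _; rewrite /GRing.scale /=; ring.
Qed.

Let dN' (t : R) : is_derive t (1 : R) N' (- 2).
Proof.
have := dmul (-2) t; congr is_derive; apply/funext => s; rewrite /N'; ring.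
Qed.

Let dD' (t : R) : is_derive t (1 : R) D' (2 * c).
Proof.
have := is_deriveD (is_derive_cst (- (2 * b)) t (1 : R)) (dmul (2 * c) t).
rewrite add0r; congr is_derive; apply/funext => s.
by rewrite /D' fctE /=; ring.
Qed.

Let dD (t : R) : is_derive t (1 : R) D (D' t).
Proof.
have h1 := is_deriveB (is_derive_cst (1 : R) t (1 : R)) (dmul (2 * b) t).
have h2 := is_deriveM (is_derive_sqr t) (is_derive_cst c t (1 : R)).
have := is_deriveD h1 h2.
have -> : D = (cst 1 - (fun s => s * (2 * b))) + (fun s => s ^+ 2) * cst c.
  by apply/funext => s; rewrite /D /= !fctE /=; ring.
by move=> h; apply: is_derive_eq h _; rewrite /D' /GRing.scale /=; ring.
Qed.

Let dI (t : R) : D t != 0 ->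
  is_derive t (1 : R) (fun s => (D s)^-1) (- ((D t)^-1 ^+ 2 * D' t)).
Proof.
move=> D0; have [dv e] := dD t; apply: DeriveDef; first exact: derivableV.
by rewrite deriveV // e exprVn /GRing.scale /= mulNr.
Qed.

Let dr (t : R) : D t != 0 -> is_derive t (1 : R) (fun s => N s / D s) (r' t).
Proof.
move=> D0; have h := is_deriveM (dN t) (dI D0).
by apply: is_derive_eq h _; rewrite /r' /GRing.scale /=; ring.
Qed.

Let D0 : D 0 = 1. Proof. by rewrite /D; ring. Qed.
Let N0 : N 0 = 1. Proof. by rewrite /N; ring. Qed.

Let D0_near : \forall t \near (0 : R), D t != 0.
Proof.
have : {for 0, continuous D}.
  by have [/derivable1_diffP/differentiable_continuous] := dD 0.
move=> /(_ [set x | x != 0]); apply.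
apply: open_nbhs_nbhs; split; first exact: open_neq.
by rewrite /= D0 oner_neq0.
Qed.

(** With r = N / D one has r(0) = 1, r'(0) = 2b and r''(0) = -2 + 8b^2 - 2c; the value is m r''(0) +
    m(m-1) r'(0)^2. *)
Lemma derive2_ratio_line :
  'D_1 ('D_1 (fun t : R => ((1 - t ^+ 2) / (1 - 2 * t * b + t ^+ 2 * c)) ^+ m))
    0
  = 4 * m%:R * (m%:R + 1) * b ^+ 2 - 2 * m%:R * c - 2 * m%:R.
Proof.
case: m => [|k].
  have -> : (fun t : R => ((1 - t ^+ 2) / (1 - 2 * t * b + t ^+ 2 * c)) ^+ 0) =
    cst 1.
    by apply/funext => t; rewrite expr0.
  have -> : 'D_1 (cst 1 : R -> R) = cst 0 by apply/funext => t;
    rewrite derive_cst.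
  by rewrite derive_cst; ring.
transitivity ('D_1 (fun t : R => (k.+1%:R * (N t / D t) ^+ k) * r' t) 0).
  apply: near_eq_derive; near=> t.
  have Dt : D t != 0 by near: t; exact: D0_near.
  by have [_ ->] := is_derive_pow k.+1 (dr Dt).
have D00 : D 0 != 0 by rewrite D0 oner_neq0.
have dk : is_derive (0 : R) (1 : R) (fun t => (N t / D t) ^+ k) (k%:R * r' 0).
  case: k => [|l].
    rewrite mul0r.
    have -> : (fun t => (N t / D t) ^+ 0) = cst 1 by apply/funext => t;
      rewrite expr0.
    exact: is_derive_cst.
  have h := is_derive_pow l.+1 (dr D00).
  by apply: is_derive_eq h _; rewrite N0 D0 divr1 expr1n mulr1.
have dr' : is_derive (0 : R) (1 : R) r' (- 2 + 8 * b ^+ 2 - 2 * c).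
  have h1 := is_deriveM (dN' 0) (dI D00).
  have h2 := is_deriveM (is_deriveM (dN 0) (is_derive_pow 2 (dI D00))) (dD' 0).
  have := is_deriveB h1 h2; have -> : r' = (N' * (fun s => (D s)^-1))
    - (N * (fun s => (D s)^-1 ^+ 2) * D').
    by apply/funext => s; rewrite /r' !fctE.
  move=> h; apply: is_derive_eq h _.
  by rewrite !fctE /GRing.scale /= D0 N0 /N' /D' invr1; ring.
have h := is_deriveM (is_deriveZ k.+1%:R dk) dr'.
have -> : (fun t => k.+1%:R * (N t / D t) ^+ k * r' t) =
   ((k.+1%:R \*: (fun t => (N t / D t) ^+ k)) * r').
  by apply/funext => t; rewrite !fctE.
have [_ ->] := h.
rewrite /GRing.scale /= /GRing.scale /= /r' /N' /D' N0 D0 invr1 mulr1 !expr1n.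
by rewrite -[k.+1]addn1 natrD; ring.
Unshelve. all: by end_near. Qed.

End Line.

Section Coordinates.
Variable n : nat.
Local Notation V := (realHn R n).
Implicit Types (eta : 'cV[H]_n).

(** Both derivatives are taken along the same axis, so only the restriction of f to it matters. *)
Lemma partial2_line (f : V -> R) i k :
  partial i k (partial i k f) 0 =
  'D_1 ('D_1 (fun t : R => f (t *: delta_mx i k))) 0.
Proof.
rewrite /partial -[X in 'D_(_) _ X = _](addr0 0) -[X in 'D_(_) _ (_ +
  X)](scale0r (delta_mx i k)).
rewrite derive_line.
have -> // : (fun t : R => 'D_(delta_mx i k) f (0 + t *: delta_mx i k)) =
    'D_1 (fun t : R => f (t *: delta_mx i k)).
apply/funext => t; rewrite derive_line.
have -> // : (fun s : R => f (0 + s *: delta_mx i k)) = (fun s : R =>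
  f (s *: delta_mx i k)).
by apply/funext => s; rewrite add0r.
Qed.

Lemma hnormsq_delta (t : R) i k : hnormsq (hcol (t *: delta_mx i k : V)) = t ^+
  2.
Proof.
rewrite hnormsq_hcolZ hnormsq_hcol (bigD1 i) //= (bigD1 k) //= !mxE !eqxx /=.
rewrite big1 => [|k' /negbTE kk]; last by rewrite mxE eqxx kk expr0n.
rewrite big1 => [|i' /negbTE ii]; first by ring.
by rewrite big1 // => k' _; rewrite mxE ii expr0n.
Qed.

Lemma hdot_delta (t : R) i k eta :
  qre (hdot (hcol (t *: delta_mx i k : V)) eta) = t * rcoord eta i k /\
  qnormsq (hdot (hcol (t *: delta_mx i k : V)) eta) = t ^+ 2 * qnormsq (eta i
    0).
Proof.
have -> : hdot (hcol (t *: delta_mx i k : V)) eta =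
    qconj (hcol (t *: delta_mx i k : V) i 0) * eta i 0.
  rewrite /hdot mxE (bigD1 i) //= big1 ?addr0 => [|j /negbTE ji];
    first by rewrite !mxE.
  rewrite !mxE ji /= !mulr0 !oppr0; exact: mul0r.
rewrite qnormsqM qnormsq_conj.
have -> : qnormsq (hcol (t *: delta_mx i k : V) i 0) = t ^+ 2.
  rewrite -(hnormsq_delta t i k) hnormsqE (bigD1 i) //= big1 ?addr0 // =>
    j /negbTE ji.
  by rewrite !mxE ji /= !mulr0 /qnormsq /= !expr0n /= !addr0.
split=> //; rewrite !mxE eqxx /=.
have inj l (l4 : (l < 4)%N) : ((inord l : 'I_4) == k) = (l == val k).
  by rewrite -val_eqE /= inordK.
rewrite !inj //; case: (eta i 0) => e0 e1 e2 e3.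
by case: k {inj} => -[|[|[|[|]]]] //= _; ring.
Qed.

Lemma rcoord_sqr_sum i eta : \sum_k rcoord eta i k ^+ 2 = qnormsq (eta i 0).
Proof. by rewrite sum_ord4 /qnormsq !mxE !inordK. Qed.

(* For |eta| = 1 the right-hand side vanishes exactly at m = 0 and m = 2n+1. *)
Lemma laplacian0_poisson_power m eta :
  laplacian0 (fun x : V => poisson_power m (hcol x) eta) 0 =
  4 * m%:R * (m%:R - 1) * hnormsq eta - 8 * m%:R * n%:R.
Proof.
rewrite /laplacian0.
transitivity (\sum_(i < n) (4 * m%:R * (m%:R - 1) * qnormsq (eta i 0) - 8 *
  m%:R)); last first.
  rewrite big_split /= -mulr_sumr -hnormsqE sumr_const card_ord.
  by rewrite mulNrn -[(_ * _) *+ n]mulr_natr.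
apply: eq_bigr => i _.
(* Over the four axes of one entry the b^2 add up to its squared norm, while c is counted four
   times: 4m(m+1) - 8m = 4m(m-1). *)
transitivity (\sum_(k < 4) (4 * m%:R * (m%:R + 1) * rcoord eta i k ^+ 2
    - (2 * m%:R * qnormsq (eta i 0) + 2 * m%:R))); last first.
  rewrite big_split /= -mulr_sumr rcoord_sqr_sum sumr_const card_ord.
  by rewrite mulNrn -[(_ + _) *+ 4]mulr_natr; ring.
apply: eq_bigr => k _; rewrite partial2_line opprD addrA -derive2_ratio_line.
have -> // : (fun t : R => poisson_power m (hcol (t *: delta_mx i k : V)) eta) =
   (fun t => ((1 - t ^+ 2) / (1 - 2 * t * rcoord eta i k
      + t ^+ 2 * qnormsq (eta i 0))) ^+ m).
apply/funext => t; have [e1 e2] := hdot_delta t i k eta.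
by rewrite /poisson_power hnormsq_delta qnormsq_1B e1 e2 mulrA.
Qed.

End Coordinates.
End LaplacianOfPowers.

(** * The chain rule from continuous partial derivatives *)

Section ChainRule.
Variables (R : realType) (n : nat).
Local Notation V := (realHn R n).

Lemma mean_value_bound (g : R -> R) (c e h : R) :
  (forall t : R, `|t| <= `|h| -> derivable g t 1 /\ `|'D_1 g t - c| <= e) ->
  `|g h - g 0 - c * h| <= e * `|h|.
Proof.
move=> gP.
have mv (a b : R) : a < b -> `|a| <= `|h| -> `|b| <= `|h| ->
    `|g b - g a - c * (b - a)| <= e * (b - a).
  move=> ab ah bh.
  have inh t : t \in `[a, b] -> `|t| <= `|h|.
    rewrite in_itv /= => /andP[at_ tb]; rewrite ler_norml.
    move: ah bh; rewrite !ler_norml => /andP[ha _] /andP[_ bh].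
    by rewrite (le_trans ha) // (le_trans tb).
  have gd x : x \in `]a, b[ -> is_derive x 1 g ('D_1 g x).
    by move=> /subset_itv_oo_cc/inh/gP[+ _] => ?; exact: DeriveDef.
  have gc : {within `[a, b], continuous g}.
    by apply: derivable_within_continuous => x /inh/gP[].
  have [d dab ->] := MVT ab gd gc.
  have [_ dc] := gP _ (inh _ (subset_itv_oo_cc dab)).
  by rewrite -mulrBl normrM (gtr0_norm (_ : 0 < b - a)) ?subr_gt0 // ler_wpM2r
    // subr_ge0 ltW.
have [h0|h0|<-] := ltgtP 0 h.
- by have := mv _ _ h0; rewrite normr0 normr_ge0 lexx !subr0 (gtr0_norm h0);
  exact.
- have := mv _ _ h0; rewrite normr0 normr_ge0 lexx sub0r (ltr0_norm h0).
  move=> /(_ isT isT); rewrite -normrN; congr (`|_| <= _); ring.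
- by rewrite subrr mulr0 subr0 normr0 mulr0.
Qed.

Lemma mean_value_bound_dir (f : V -> R) (x v : V) (c e h : R) :
  (forall t : R, `|t| <= `|h| ->
    derivable f (x + t *: v) v /\ `|'D_v f (x + t *: v) - c| <= e) ->
  `|f (x + h *: v) - f x - c * h| <= e * `|h|.
Proof.
move=> fP; have := @mean_value_bound (fun s => f (x + s *: v)) c e h.
rewrite scale0r addr0; apply => t /fP[].
by rewrite derivable_line derive_line.
Qed.

(** Continuous partials imply differentiability: go from p to p + h one coordinate at a time and
    apply the mean value bound to each step. *)
Lemma linear_expansion (U : set V) (f : V -> R) (p : V) (e : R) :
  open U -> U p -> 0 < e ->
  (forall i j x, U x -> derivable f x (delta_mx i j)) ->
  (forall i j, {for p, continuous (partial i j f)}) ->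
  \forall h \near (0 : V),
    `|f (p + h) - f p - \sum_ij partial ij.1 ij.2 f p * h ij.1 ij.2| <= e *
      `|h|.
Proof.
move=> oU Up e0 fd fc.
(* N counts the coordinates; dividing by N + 1 keeps e' positive even when N = 0 and gives N e' <=
   e. *)
pose N := size (index_enum ('I_n * 'I_4)%type).
pose e' := e / N.+1%:R.
have e'0 : 0 < e' by rewrite divr_gt0.
have : \forall x \near p, U x /\ forall ij : 'I_n * 'I_4,
    `|partial ij.1 ij.2 f x - partial ij.1 ij.2 f p| <= e'.
  near=> x; split; first by near: x; exact: open_nbhs_nbhs.
  near: x; apply: filter_forall => ij.
  have /(@cvgrPdist_le _ _ _ _ (nbhs_filter p))/(_ _ e'0) := fc ij.1 ij.2.
  by apply: filterS => x; rewrite distrC.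
move=> /nbhs_ballP[d /= d0 dP].
near=> h.
have hd : `|h| < d.
  by near: h; apply/nbhs_ballP; exists d => // y;
    rewrite -ball_normE /= sub0r normrN.
have key (s : seq ('I_n * 'I_4)) : uniq s ->
    `|f (p + \sum_(ij <- s) h ij.1 ij.2 *: delta_mx ij.1 ij.2) - f p
      - \sum_(ij <- s) partial ij.1 ij.2 f p * h ij.1 ij.2|
    <= (size s)%:R * e' * `|h|.
  elim: s => [|[i j] s IHs] /=.
    by rewrite !big_nil addr0 subrr subr0 normr0 !mul0r.
  move=> /andP[ijs us]; rewrite !big_cons /=.
  set w := \sum_(ij <- s) _ *: _.
  set l := \sum_(ij <- s) _ * _.
  have wE i' j' : w i' j' = if (i', j') \in s then h i' j' else 0.
    rewrite /w summxE; case: ifPn => ijs'.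
      rewrite (bigD1_seq (i', j')) //= !mxE !eqxx mulr1 big1 ?addr0 // =>
        -[a b] /= ab.
      by move: ab; rewrite !mxE xpair_eqE (eq_sym a) (eq_sym b) => /negbTE ->;
        rewrite mulr0.
    rewrite big_seq big1 // => -[a b] /= abs.
    have : (a, b) != (i', j') by apply: contraNneq ijs' => <-.
    by rewrite !mxE xpair_eqE (eq_sym a) (eq_sym b) => /negbTE ->;
      rewrite mulr0.
  (* The norm is the maximum over the entries, and each entry of an intermediate point is 0, an
     entry of h or at most one in absolute value; the whole path therefore stays in the ball of
     radius d. *)
  have bd t : `|t| <= `|h i j| -> `|w + t *: delta_mx i j| <= `|h|.
    move=> th; apply: mx_norm_le => // a b; rewrite !mxE wE.
    case: ifPn => abs.
      suff -> : (a == i) && (b == j) = false by rewrite mulr0 addr0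
        coord_le_mx_norm.
      by apply/negbTE/negP => /andP[/eqP ai /eqP bj]; move: ijs;
        rewrite -ai -bj abs.
    rewrite add0r; case: (_ && _); last by rewrite mulr0 normr0.
    by rewrite mulr1 (le_trans th) // coord_le_mx_norm.
  have step : `|f (p + w + h i j *: delta_mx i j) - f (p + w)
      - partial i j f p * h i j| <= e' * `|h i j|.
    apply: mean_value_bound_dir => t /bd th.
    have /dP[Ux /(_ (i, j)) /= xp] : ball p d (p + w + t *: delta_mx i j).
      rewrite -ball_normE /= -addrA opprD addNKr normrN.
      exact: le_lt_trans th hd.
    by split; [exact: fd|].
  have -> : f (p + (h i j *: delta_mx i j + w)) - f p - (partial i j f p * h i
    j + l)
     = (f (p + w + h i j *: delta_mx i j) - f (p + w) - partial i j f p * h i j)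
       + (f (p + w) - f p - l).
    by rewrite (addrC (_ *: _)) addrA; ring.
  apply: le_trans (ler_normD _ _) _.
  rewrite -[(size s).+1]add1n natrD !mulrDl mul1r lerD //; last exact: IHs.
  by apply: le_trans step _; rewrite ler_wpM2l ?coord_le_mx_norm // ltW.
have := key (index_enum _) (index_enum_uniq _).
rewrite -(pair_bigA _ (fun i j => h i j *: delta_mx i j)) /= -matrix_sum_delta.
move=> /le_trans; apply.
by rewrite ler_wpM2r // /e' mulrCA ger_pMr // ler_pdivrMr // mul1r ler_nat.
Unshelve. all: by end_near. Qed.

Lemma chain_rule (U : set V) (f : V -> R) (g : R -> V) (dg : V) :
  open U -> U (g 0) ->
  (forall i j x, U x -> derivable f x (delta_mx i j)) ->
  (forall i j, {for g 0, continuous (partial i j f)}) ->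
  (forall i j, is_derive (0 : R) (1 : R) (fun t => g t i j) (dg i j)) ->
  is_derive (0 : R) (1 : R) (f \o g)
    (\sum_ij partial ij.1 ij.2 f (g 0) * dg ij.1 ij.2).
Proof.
move=> oU Up fd fc gd; set L := \sum_ij _.
have gq i j : h^-1 * (g h i j - g 0 i j) @[h --> (0 : R)^'] --> dg i j.
  have [/cvg_ex[/= l gl] ge] := gd i j.
  have <- : l = dg i j by rewrite -ge; apply/esym/cvg_lim.
  by move: gl; under eq_fun do rewrite /GRing.scale /= mulr1 addr0.
have gc : g h @[h --> (0 : R)^'] --> g 0.
  apply: cvg_mx => i j.
  have /derivable1_diffP/differentiable_continuous : derivable (fun t =>
    g t i j) 0 1 by have [] := gd i j.
  by move=> c; apply: cvg_trans c; apply: cvg_app; exact: nbhs_dnbhs.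
have : h^-1 * (f (g h) - f (g 0)) @[h --> (0 : R)^'] --> L.
  apply/cvgrPdist_le => e e0.
  (* C bounds the difference quotients of g for small h: they converge to the entries of [dg], and 1
     is the allowed deviation. Dividing e/2 by C compensates for |g h - g 0| <= C |h|. *)
  pose C := `|dg| + 1.
  have C0 : 0 < C by rewrite ltr_pwDr.
  have lin : \sum_ij partial ij.1 ij.2 f (g 0) * (h^-1 * (g h ij.1 ij.2 - g 0
    ij.1 ij.2)) @[h --> (0 : R)^'] --> L.
    apply: (cvg_big (x0 := 0)) => [|ij _]; first exact: add_continuous.
    by apply: cvgM => //; exact: cvg_cst.
  have e1 : 0 < e / 2 by rewrite divr_gt0.
  have e2 : 0 < e / 2 / C by rewrite divr_gt0.
  have E := linear_expansion oU Up e2 fd fc.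
  have gc0 : g h - g 0 @[h --> (0 : R)^'] --> (0 : V).
    by rewrite -(subrr (g 0)); apply: cvgB => //; exact: cvg_cst.
  near=> h.
  have h0 : h != 0 by near: h; exact: nbhs_dnbhs_neq.
  have l1 : `|L - \sum_ij partial ij.1 ij.2 f (g 0) * (h^-1 * (g h ij.1 ij.2 -
    g 0 ij.1 ij.2))| <= e / 2.
    by near: h; move/cvgrPdist_le : lin; exact.
  have l2 : `|f (g 0 + (g h - g 0)) - f (g 0) - \sum_ij partial ij.1 ij.2 f (g
    0) * (g h - g 0) ij.1 ij.2| <= e / 2 / C * `|g h - g 0|.
    by near: h; exact: (gc0 _ E).
  have l3 : `|g h - g 0| <= C * `|h|.
    apply: mx_norm_le => [|i j]; first by rewrite mulr_ge0 // ltW.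
    have : `|h^-1 * (g h i j - g 0 i j)| <= C.
      have : `|dg i j - h^-1 * (g h i j - g 0 i j)| <= 1.
        move: i j; near: h; apply: filter_forall => i;
          apply: filter_forall => j.
        by have /cvgrPdist_le := gq i j; exact.
      move=> q; rewrite -[X in `|X|](subKr (dg i j)).
      apply: le_trans (ler_normB _ _) _; rewrite lerD //.
      exact: coord_le_mx_norm.
    by rewrite normrM normfV ler_pdivrMl ?normr_gt0 // mulrC !mxE.
  rewrite (addrC (g 0)) subrK in l2.
  set T := \sum_ij _ in l2; set T' := \sum_ij _ in l1.
  have TT : T' = h^-1 * T.
    by rewrite mulr_sumr; apply: eq_bigr => ij _; rewrite !mxE mulrCA.
  rewrite -(subrKA T') (le_trans (ler_normD _ _)) // (splitr e) lerD //.
  rewrite distrC TT -mulrBr normrM normfV ler_pdivrMl ?normr_gt0 //.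
  apply: le_trans l2 _; rewrite mulrC (mulrC _ (e / 2)).
  apply: (@le_trans _ _ (C * `|h| * (e / 2 / C)));
    first by rewrite ler_wpM2r // ltW.
  by rewrite le_eqVlt; apply/orP; left; apply/eqP; field; exact: lt0r_neq0.
move=> cl.
have {}cl : h^-1 *: (((f \o g) \o shift 0) (h *: 1) - (f \o g) 0) @[h --> (0 :
  R)^'] --> L.
  by under eq_fun do rewrite /= /GRing.scale /= mulr1 addr0.
apply: DeriveDef; first by apply/cvg_ex; exists L.
exact/cvg_lim.
Unshelve. all: by end_near. Qed.

End ChainRule.

(** * Second derivative test and linearity of the Laplacian *)

Section MaximumPrinciple.
Variables (R : realType) (n : nat).
Local Notation V := (realHn R n).
Local Notation Q x := (hnormsq (hcol (x : V))).

(** At the maximum g' vanishes. If g''(0) > 0, then g' > 0 just to the right of 0 and the mean value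
    theorem gives g(h) > g(0). The second derivative is required at 0 only. *)
Lemma second_derivative_max (g : R -> R) :
  (\forall t \near (0 : R), derivable g t 1) -> derivable ('D_1 g) (0 : R) 1 ->
  (\forall t \near (0 : R), g t <= g 0) -> 'D_1 ('D_1 g) 0 <= 0.
Proof.
move=> gd g2 gm; rewrite leNgt; apply/negP => L0.
have [d /= d0 dP] : exists2 d : R, 0 < d & forall t, `|t| < d ->
    derivable g t 1 /\ g t <= g 0.
  have : \forall t \near (0 : R), derivable g t 1 /\ g t <= g 0 by exact:
    filterI.
  move=> /nbhs_ballP[d d0 dP].
  by exists d => // t td; apply: dP; rewrite /ball /= sub0r normrN.
have g10 : 'D_1 g 0 = 0.
  have itv t : t \in `](- d), d[ -> `|t| < d by rewrite in_itv /= ltr_norml.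
  have d0d : - d <= d by rewrite (le_trans _ (ltW d0)) // oppr_le0 ltW.
  have [||| _ -> //] := @derive1_at_max R g (- d) d 0 d0d.
  - by move=> t /itv/dP[].
  - by rewrite in_itv /= oppr_lt0 d0.
  - by move=> t /itv/dP[].
have [e /= e0 eP] : exists2 e : R, 0 < e & forall t, 0 < t -> t < e ->
  0 < 'D_1 g t.
  have : h^-1 * 'D_1 g h @[h --> (0 : R)^'] --> 'D_1 ('D_1 g) 0.
    move/cvg_ex : g2 => [/= l gl].
    have -> : 'D_1 ('D_1 g) 0 = l by apply/cvg_lim.
    by move: gl; under eq_fun do rewrite /GRing.scale /= mulr1 addr0 g10 subr0.
  move=> /cvgr_gt/(_ _ L0)[e /= e0 eP]; exists e => // t t0 te.
  have := eP t; rewrite /= sub0r normrN gtr0_norm // => /(_ te (lt0r_neq0 t0)).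
  by rewrite pmulr_rgt0 // invr_gt0.
pose h := Num.min d e / 2.
have m0 : 0 < Num.min d e by rewrite lt_min d0.
have h0 : 0 < h by rewrite divr_gt0.
have hm : h < Num.min d e by rewrite /h ltr_pdivrMr // ltr_pMr // ltr1n.
have /andP[hd he] : (h < d) && (h < e) by rewrite -lt_min.
have inh t : t \in `[0, h] -> `|t| < d.
  by rewrite in_itv /= => /andP[t0 th]; rewrite ger0_norm // (le_lt_trans th).
have [c ch gE] : exists2 c, c \in `]0, h[ & g h - g 0 = 'D_1 g c * (h - 0).
  apply: MVT => // [t th|].
    by have [gt _] := dP _ (inh _ (subset_itv_oo_cc th)); exact: DeriveDef.
  by apply: derivable_within_continuous => t /inh/dP[].
have : 0 < g h - g 0.
  rewrite gE subr0 mulr_gt0 //; move: ch; rewrite in_itv /= => /andP[c0 ch].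
  by apply: eP => //; exact: lt_trans he.
by rewrite subr_gt0 ltNge (dP h _).2 // gtr0_norm.
Qed.

(* The regularity at 0 of f \o phi_a that the definition of the invariant
   Laplacian uses: 'D is a junk value where the derivative does not exist. *)
Definition twice_derivable (f : V -> R) : Prop := forall i k,
  (\forall x \near (0 : V), derivable f x (delta_mx i k)) /\
  derivable (partial i k f) 0 (delta_mx i k).

Lemma laplacian0_near_eq (f g : V -> R) : (\forall x \near (0 : V),
  f x = g x) ->
  laplacian0 f 0 = laplacian0 g 0.
Proof.
move=> fg; apply: eq_bigr => i _; apply: eq_bigr => k _.
apply: near_eq_derive.
have := near_join fg; apply: filterS => x xfg.
exact: near_eq_derive.
Qed.

Lemma partial_linear (f g : V -> R) c i k x :
  derivable f x (delta_mx i k) -> derivable g x (delta_mx i k) ->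
  is_derive x (delta_mx i k) (fun x => f x + c * g x)
    (partial i k f x + c * partial i k g x).
Proof.
move=> df dg.
exact: (is_deriveD (derivableP df) (is_deriveZ c (derivableP dg))).
Qed.

(** [twice_derivable] supplies exactly the existence of derivatives under which ['D] is additive:
    first order near 0, second order at 0. *)
Lemma laplacian0_linear (f g : V -> R) c : twice_derivable f ->
  twice_derivable g ->
  laplacian0 (fun x => f x + c * g x) 0 = laplacian0 f 0 + c * laplacian0 g 0.
Proof.
move=> tf tg; rewrite /laplacian0 mulr_sumr -big_split;
  apply: eq_bigr => i _ /=.
rewrite mulr_sumr -big_split; apply: eq_bigr => k _ /=.
have [nf df] := tf i k; have [ng dg] := tg i k.
have [_ <-] := partial_linear c df dg.
apply: near_eq_derive; near=> x.
have fx : derivable f x (delta_mx i k) by near: x.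
have gx : derivable g x (delta_mx i k) by near: x.
by have [_ <-] := partial_linear c fx gx.
Unshelve. all: by end_near. Qed.

Lemma partial_cst (c : R) i k : partial i k (fun _ : V => c) = fun _ => 0.
Proof. by apply/funext => y; rewrite /partial; exact: derive_cst. Qed.

Lemma laplacian0_cst (c : R) (x : V) : laplacian0 (fun _ => c) x = 0.
Proof.
rewrite /laplacian0 big1 // => i _; rewrite big1 // => k _.
by rewrite !partial_cst.
Qed.

Lemma twice_derivable_cst (c : R) : twice_derivable (fun _ => c).
Proof.
move=> i k; split; first by near=> x; exact: derivable_cst.
by rewrite partial_cst; exact: derivable_cst.
Unshelve. all: by end_near. Qed.

Lemma is_C2_twice_derivable (U : set V) f : open U -> U 0 -> is_Ck 2 U f ->
  twice_derivable f.
Proof.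
move=> oU U0 [_ Cf] i k; have [fd [_ /(_ i k)[fdd _]]] := Cf i k.
split; last exact: fdd.
by near=> x; apply: fd; near: x; exact: open_nbhs_nbhs.
Unshelve. all: by end_near. Qed.

Lemma laplacian0_max (f : V -> R) : twice_derivable f ->
  (\forall x \near (0 : V), f x <= f 0) -> laplacian0 f 0 <= 0.
Proof.
move=> tf fm; apply: sumr_le0 => i _; apply: sumr_le0 => k _.
have [nf df] := tf i k; rewrite partial2_line.
set v : V := delta_mx i k.
have ct : t *: v @[t --> (0 : R)] --> (0 : V).
  by rewrite -[X in _ --> X](scale0r v); exact: scalel_continuous.
have lE : (fun t : R => 'D_v f (0 + t *: v)) = 'D_1 (fun t : R => f (t *: v)).
  apply/funext => t; rewrite derive_line.
  by rewrite (_ : (fun s : R => f (0 + s *: v)) = fun s => f (s *: v)) //;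
    apply/funext => s; rewrite add0r.
have dl t : derivable f (t *: v) v -> derivable (fun s : R => f (s *: v)) t 1.
  rewrite -{1}[t *: v]add0r derivable_line.
  by rewrite (_ : (fun s : R => f (0 + s *: v)) = fun s => f (s *: v)) //;
    apply/funext => s; rewrite add0r.
apply: second_derivative_max.
- have : \forall t \near (0 : R), derivable f (t *: v) v := ct _ nf.
  by apply: filterS => t; exact: dl.
- have df' : derivable ('D_v f) (0 + (0 : R) *: v) v by rewrite scale0r addr0.
  rewrite -lE; exact: (derivable_line ('D_v f) 0 v 0).1 df'.
- by rewrite scale0r; exact: (ct _ fm).
Qed.

(** * Composition with phi_a in real coordinates *)

Definition rmobius (a x : V) : V := rcoord (mobius (hcol a) (hcol x)).

Lemma hcol_rmobius a x : hcol (rmobius a x) = mobius (hcol a) (hcol x).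
Proof. exact: rcoordK. Qed.

Lemma rmobius0 a : rmobius a 0 = a.
Proof. by rewrite /rmobius hcol0 mobius0 hcolK. Qed.

Lemma qball0 : qball R n 0.
Proof. by rewrite qballE /= hcol0 hnormsq0 ltr01. Qed.

Lemma rmobius_qball a x : qball R n a -> qball R n x -> qball R n (rmobius a x).
Proof. by rewrite !qballE => a1 x1; rewrite /= hcol_rmobius;
  exact: mobius_open. Qed.

Lemma sk_rcoord (Z : topologicalType) (U : set V) (S : set Z) (K : V -> Z ->
  'cV[quat R]_n) i k :
  smooth_qkernel U S (fun x z => K x z i 0) ->
  smooth_kernel U S (fun x z => rcoord (K x z) i k).
Proof.
move=> [s0 s1 s2 s3]; under eq_fun => x do under eq_fun do rewrite mxE.
by case: k => -[|[|[|[|]]]].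
Qed.

Lemma sk_rmobius (Z : topologicalType) (S : set Z) (U : set V) a i k :
  (forall x, U x -> 1 - hdot (hcol a) (hcol x) != 0) ->
  smooth_kernel U S (fun x _ => rmobius a x i k).
Proof. by move=> a0; apply: sk_rcoord; exact: sqk_mobius. Qed.

Lemma sk_rmobius_qball (Z : topologicalType) (S : set Z) a i k : qball R n a ->
  smooth_kernel (qball R n) S (fun x _ => rmobius a x i k).
Proof.
rewrite qballE => a1; apply: sk_rmobius => x x1.
by apply: hdot_lt1 => //; exact: ltW.
Qed.

Lemma rmobius_derive a v : qball R n a -> exists dPhi : V -> V,
  (forall x i k, qball R n x ->
     is_derive x v (fun y => rmobius a y i k) (dPhi x i k)) /\
  (forall x i k w, qball R n x -> derivable (fun y => dPhi y i k) x w).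
Proof.
move=> a1.
have /choice[D DP] : forall ik : 'I_n * 'I_4, exists dK : V -> R,
    (forall x, qball R n x -> is_derive x v (fun y =>
      rmobius a y ik.1 ik.2) (dK x)) /\
    (forall x w, qball R n x -> derivable dK x w).
  (* The coordinates of phi_a are kernels with a dummy parameter in V, evaluated at 0 below. *)
  move=> [i k]; have sPhi := sk_rmobius_qball [set: V] i k a1.
  have [dK sdK KdK] := sk_derive v sPhi; exists (dK ^~ 0).
  split=> [x x1|x w x1]; first exact: (KdK x 0).
  have [ddK _ /(_ x 0 x1)] := sk_derive w sdK.
  by case.
exists (fun x => \matrix_(i, k) D (i, k) x); split=> [x i k x1|x i k w x1].
  by rewrite mxE; exact: (DP (i, k)).1.
under eq_fun do rewrite mxE; exact: (DP (i, k)).2.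
Qed.

Lemma rmobius_comp_derive a v f x dPhi : qball R n a -> qball R n x ->
  is_Ck 1 (qball R n) f ->
  (forall i k, is_derive x v (fun y => rmobius a y i k) (dPhi i k)) ->
  is_derive x v (fun y => f (rmobius a y))
    (\sum_ij partial ij.1 ij.2 f (rmobius a x) * dPhi ij.1 ij.2).
Proof.
move=> a1 x1 [_ Cf] dP.
have := @chain_rule R n (qball R n) f (fun t =>
  rmobius a (x + t *: v)) (\matrix_(i, k) dPhi i k) (@open_qball R n).
rewrite scale0r addr0.
have -> : \sum_ij partial ij.1 ij.2 f (rmobius a x) * (\matrix_(i,
  k) dPhi i k) ij.1 ij.2 = \sum_ij partial ij.1 ij.2 f (rmobius a x) * dPhi
    ij.1 ij.2.
  by apply: eq_bigr => ij _; rewrite mxE.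
move=> h; apply/(is_derive_line0 (fun y => f (rmobius a y))); apply: h.
- exact: rmobius_qball.
- by move=> i j y y1; have [+ _] := Cf i j; exact.
- by move=> i j; have [_ [+ _]] := Cf i j; apply; exact: rmobius_qball.
- by move=> i j; rewrite mxE; apply/(is_derive_line0 (fun y =>
  rmobius a y i j)).
Qed.

(** The chain rule gives the first derivative on the ball as the sum [F] of products of (partial f)
    o phi_a and derivatives of phi_a. The first factors are C^1 functions composed with phi_a, so
    the chain rule applies once more. *)
Lemma rmobius_comp_twice_derivable a f : qball R n a -> is_Ck 2 (qball R n) f ->
  twice_derivable (fun x => f (rmobius a x)).
Proof.
move=> a1 Cf i k.
have Cf1 : is_Ck 1 (qball R n) f.
  case: Cf => fc fd; split=> // i' j'; have [d [c _]] := fd i' j'.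
  by split.
have [dPhi [dP ddP]] := rmobius_derive (delta_mx i k) a1.
have D x (x1 : qball R n x) :=
  rmobius_comp_derive a1 x1 Cf1 (fun i k => dP x i k x1).
have nb : \forall x \near (0 : V), qball R n x.
  by apply: open_nbhs_nbhs; split; [exact: open_qball|exact: qball0].
split; first by near=> x; have [] // := D x _; near: x.
pose F x := \sum_ij partial ij.1 ij.2 f (rmobius a x) * dPhi x ij.1 ij.2.
apply: (@near_eq_derivable _ _ _ F).
  near=> x; have x1 : qball R n x by near: x.
  by have [_ e] := D x x1; rewrite /F -e.
have -> : F = \sum_ij (fun x => partial ij.1 ij.2 f (rmobius a x) * dPhi x ij.1
  ij.2).
  by apply/funext => x; rewrite /F fct_sumE.
elim/big_ind: _ => [|? ? ? ?|ij _]; first exact: derivable_cst.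
  exact: derivableD.
apply: derivableM; last by apply: ddP; exact: qball0.
have [_ Cp] := Cf.2 ij.1 ij.2.
by have [] := rmobius_comp_derive a1 qball0 Cp (fun i k => dP 0 i k qball0).
Unshelve. all: by end_near. Qed.

Lemma is_Ck_linear k (U : set V) f g c : open U -> is_Ck k U f -> is_Ck k U g ->
  is_Ck k U (fun x => f x + c * g x).
Proof.
move=> oU; elim: k f g => [|k IHk] f g [fc fd] [gc gd].
all: split; first by move=> x Ux; apply: continuousD;
  [exact: fc|apply: continuousM; [exact: cst_continuous|exact: gc]].
  by [].
move=> i j; have [df Cf] := fd i j; have [dg Cg] := gd i j.
have D x (Ux : U x) := partial_linear c (df x Ux) (dg x Ux).
split=> [x Ux|]; first by have [] := D x Ux.
apply: is_Ck_eq oU _ (IHk _ _ Cf Cg) => x Ux.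
by have [_ <-] := D x Ux.
Qed.

Lemma invariant_laplacianE f a :
  invariant_laplacian f a = laplacian0 (fun x => f (rmobius a x)) 0.
Proof. by []. Qed.

Lemma invariant_laplacian_linear f g c a : qball R n a ->
  is_Ck 2 (qball R n) f -> is_Ck 2 (qball R n) g ->
  invariant_laplacian (fun x => f x + c * g x) a =
  invariant_laplacian f a + c * invariant_laplacian g a.
Proof.
move=> a1 Cf Cg; rewrite !invariant_laplacianE.
by rewrite laplacian0_linear //; exact: rmobius_comp_twice_derivable.
Qed.

Lemma is_C2_hnormsq : is_Ck 2 (qball R n) (fun x => Q x).
Proof.
have := @sk_Ck R n V (qball R n) setT (@open_qball R n) 2 (fun x _ => Q x) 0.
by apply => //; exact: sk_hnormsq.
Qed.

Lemma sk_poisson_power_cst m eta : hnormsq eta <= 1 ->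
  smooth_kernel (qball R n) [set: V] (fun x _ => poisson_power m (hcol x) eta).
Proof.
move=> e1; apply: sk_poisson_power => [i|x z]; first exact: sqk_cst.
by rewrite qballE => x1 _; exact: hdot_lt1.
Qed.

Lemma invariant_laplacian_hnormsq a : qball R n a ->
  invariant_laplacian (fun x => Q x) a = 8 * n%:R * (1 - Q a).
Proof.
move=> a1; rewrite invariant_laplacianE.
have a1' := a1; rewrite qballE /= in a1'.
(* By [hnormsq_mobius], |phi_a(x)|^2 is 1 minus (1 - |a|^2) times the Poisson ratio at (x, a). *)
rewrite (laplacian0_near_eq (g := fun x => 1 + (- (1 - Q a)) * poisson_power 1
  (hcol x) (hcol a))).
  rewrite laplacian0_linear; last 2 first.
  - exact: twice_derivable_cst.
  - apply: (is_C2_twice_derivable (@open_qball R n) qball0).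
    by have := sk_Ck (z := 0 : V) (@open_qball R n) 2 (sk_poisson_power_cst 1
      (ltW a1')); exact.
  by rewrite laplacian0_cst laplacian0_poisson_power; ring.
near=> x.
have x1 : qball R n x.
  by near: x; apply: open_nbhs_nbhs; split; [exact: open_qball|exact: qball0].
rewrite qballE /= in x1.
have := hnormsq_mobius a1' (hdot_lt1 a1' (ltW x1)).
rewrite hcol_rmobius /poisson_power expr1 (qnormsq_hdotC (hcol x)) -mulrA => e.
by apply: oppr_inj; rewrite opprD mulNr opprK -e; ring.
Unshelve. all: by end_near. Qed.

(** * Maximum principle and uniqueness *)

Hypothesis n_gt0 : (0 < n)%N.

(* r is the square of the radius.  A small multiple of |x|^2, whose invariant
   Laplacian 8n(1 - |x|^2) is positive, makes f strictly subharmonic. *)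
Lemma maximum_principle (r M : R) (f : V -> R) : r <= 1 ->
  is_Ck 2 (qball R n) f ->
  {within [set x | Q x <= r], continuous f} ->
  (forall a, Q a < r -> invariant_laplacian f a = 0) ->
  (forall a, Q a = r -> f a <= M) ->
  forall a, Q a <= r -> f a <= M.
Proof.
move=> r1 Cf fc fh fM a0 a0r; rewrite leNgt; apply/negP => Ma0.
(* Half the gap: g(a0) >= f(a0) = M + 2e, while g <= M + e r <= M + e on the boundary, so g attains
   its maximum in the interior. *)
pose e := (f a0 - M) / 2.
have e0 : 0 < e by rewrite divr_gt0 // subr_gt0.
pose g x := f x + e * Q x.
have gc : {within [set x | Q x <= r], continuous g}.
  move=> x; apply: cvgD; first exact: fc.
  apply: cvgM; first exact: cvg_cst.
  by apply: continuous_subspaceT => y; exact: hnormsq_hcol_continuous.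
have [c cr cmax] := compact_EVT_max (ex_intro _ a0 a0r) (@compact_hnormsq_le R
  n r) gc.
rewrite inE /= in cr.
have gc0 : M + e < g c.
  apply: (@lt_le_trans _ _ (g a0)); last by apply: cmax; rewrite inE.
  have : 0 <= e * Q a0 by rewrite mulr_ge0 ?hnormsq_ge0 // ltW.
  have : 0 < e by [].
  by rewrite /g /e; lra.
have cr' : Q c < r.
  rewrite lt_neqAle cr andbT; apply/eqP => cE.
  have : e * r <= e by rewrite -[leRHS]mulr1 ler_wpM2l // ltW.
  by have := fM _ cE; move: gc0; rewrite /g cE; lra.
have c1 : qball R n c by rewrite qballE /=; exact: lt_le_trans r1.
have Cg : is_Ck 2 (qball R n) g.
  exact: (is_Ck_linear e (@open_qball R n) Cf is_C2_hnormsq).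
(* phi_c is continuous with phi_c(0) = c, so g o phi_c has a local maximum at 0; yet its Laplacian
   there is 8ne(1 - |c|^2) > 0. *)
have : invariant_laplacian g c <= 0.
  apply: laplacian0_max; first exact: rmobius_comp_twice_derivable.
  change (\forall x \near (0 : V), g (rmobius c x) <= g (rmobius c 0)).
  near=> x; rewrite rmobius0; apply: cmax; rewrite inE /=; apply: ltW.
  near: x; have : {for 0, continuous (fun x => Q (rmobius c x))}.
    apply: (@sk_continuous R n V (qball R n) setT (fun x _ =>
      Q (rmobius c x)) 0 0) => //; last exact: qball0.
    rewrite (_ : (fun x _ => _) = fun x (_ : V) =>
      \sum_i \sum_k rmobius c x i k ^+ 2).
      apply: sk_sum => i; apply: sk_sum => k; apply: sk_exp;
        exact: sk_rmobius_qball.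
    by apply/funext => x; apply/funext => _; rewrite hnormsq_hcol.
  by move=> /(_ [set y | y < r]); apply; apply: open_nbhs_nbhs; split;
    [exact: open_lt|rewrite /= rmobius0].
rewrite leNgt => /negP; apply.
rewrite (invariant_laplacian_linear e c1 Cf is_C2_hnormsq).
have c1' : Q c < 1 by move: c1; rewrite qballE.
by rewrite fh // add0r invariant_laplacian_hnormsq // !mulr_gt0 ?ltr0n //
  subr_gt0.
Unshelve. all: by end_near. Qed.

Lemma harmonic_unique (r : R) (f g : V -> R) : r <= 1 ->
  is_Ck 2 (qball R n) f -> is_Ck 2 (qball R n) g ->
  {within [set x | Q x <= r], continuous f} ->
  {within [set x | Q x <= r], continuous g} ->
  (forall a, Q a < r -> invariant_laplacian f a = 0) ->
  (forall a, Q a < r -> invariant_laplacian g a = 0) ->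
  (forall a, Q a = r -> f a = g a) ->
  forall a, Q a <= r -> f a = g a.
Proof.
move=> r1.
have half (F G : V -> R) : is_Ck 2 (qball R n) F -> is_Ck 2 (qball R n) G ->
    {within [set x | Q x <= r], continuous F} ->
    {within [set x | Q x <= r], continuous G} ->
    (forall a, Q a < r -> invariant_laplacian F a = 0) ->
    (forall a, Q a < r -> invariant_laplacian G a = 0) ->
    (forall a, Q a = r -> F a = G a) ->
    forall a, Q a <= r -> F a <= G a.
  move=> CF CG cF cG hF hG FG a ar.
  have := @maximum_principle r 0 (fun x => F x + (-1) * G x) r1.
  move=> /(_ (is_Ck_linear _ (@open_qball R n) CF CG)) mp.
  rewrite -subr_le0 -mulN1r; apply: mp ar.
  - by move=> x; apply: cvgD; [exact: cF|apply: cvgM;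
    [exact: cvg_cst|exact: cG]].
  - move=> b br; have b1 : qball R n b by rewrite qballE /=;
    exact: lt_le_trans r1.
    by rewrite invariant_laplacian_linear // hF // hG // mulr0 addr0.
  - by move=> b br; rewrite FG // mulN1r subrr.
move=> Cf Cg cf cg hf hg fg a ar; apply/eqP; rewrite eq_le !half //.
by move=> b br; rewrite fg.
Qed.

End MaximumPrinciple.

(** * Harmonicity of Poisson integrals *)

Section PoissonIntegral.
Variables (R : realType) (n : nat).
Local Notation V := (realHn R n).
Local Notation Q x := (hnormsq (hcol (x : V))).
Local Notation S := (qsphere R n).
Local Notation B := (qball R n).

(** Changes the role of a variable: smoothness in the point variable gives continuity, so the
    function may serve as a coefficient in the parameter. [z0] is a dummy value. *)
Lemma sk_freeze (U S' : set V) (K : V -> V -> R) z0 :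
  smooth_kernel S' [set: V] K -> smooth_kernel U S' (fun _ z => K z z0).
Proof.
move=> sK; apply: sk_param; apply: continuous_in_subspaceT => z;
  rewrite inE => Sz.
exact: (sk_continuous sK).
Qed.

Lemma sqk_freeze (U S' : set V) (K : V -> V -> quat R) z0 :
  smooth_qkernel S' [set: V] K -> smooth_qkernel U S' (fun _ z => K z z0).
Proof.
move=> [s0 s1 s2 s3]; split.
- exact: (sk_freeze U z0 s0).
- exact: (sk_freeze U z0 s1).
- exact: (sk_freeze U z0 s2).
- exact: (sk_freeze U z0 s3).
Qed.

Lemma sk_poisson : smooth_kernel B S (fun x z =>
  poisson_kernel (hcol x) (hcol z)).
Proof.
apply: sk_poisson_power => [i|x z].
  exact: (sqk_freeze _ 0 (sqk_hcol S [set: V] i)).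
by rewrite qballE qsphereE => x1 z1; apply: hdot_lt1 => //; rewrite z1.
Qed.

Lemma sk_poisson_mobius a : B a ->
  smooth_kernel B S (fun x z => poisson_kernel (hcol x) (mobius (hcol a) (hcol
    z))).
Proof.
rewrite qballE /= => a1; apply: sk_poisson_power => [i|x z].
  apply: (sqk_freeze _ 0 (@sqk_mobius _ _ _ S [set: V] (hcol a) i _)) => z.
  by rewrite qsphereE /= => z1; apply: hdot_lt1 => //; rewrite z1.
rewrite qsphereE => x1 z1; apply: hdot_lt1 => //.
by rewrite mobius_sphere.
Qed.

Variable sigma : probability (borelHn R n) R.

Section Density.
Variable phi : V -> R.
Hypothesis phi_cont : {within S, continuous phi}.

Lemma sk_poisson_density :
  smooth_kernel B S (fun x z => poisson_kernel (hcol x) (hcol z) * phi z).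
Proof. by apply: sk_mul; [exact: sk_poisson|exact: sk_param]. Qed.

Lemma poisson_integral_C2 : is_Ck 2 B (poisson_integral sigma phi).
Proof.
exact: (kernel_integral_Ck sigma (@open_qball R n) (@compact_qsphere R n) 2
  sk_poisson_density).
Qed.

Lemma laplacian0_poisson_scaled c eta : hnormsq eta = 1 ->
  laplacian0 (fun x : V => c * poisson_kernel (hcol x) eta) 0 = 0.
Proof.
move=> e1; have -> : (fun x : V => c * poisson_kernel (hcol x) eta) =
    (fun x => 0 + c * poisson_power (2 * n).+1 (hcol x) eta).
  by apply/funext => x; rewrite add0r.
rewrite laplacian0_linear; last 2 first.
- exact: twice_derivable_cst.
- apply: (is_C2_twice_derivable (@open_qball R n) (@qball0 R n)).
  apply: (sk_Ck (z := 0 : V) (@open_qball R n) 2 (sk_poisson_power_cst (2 *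
    n).+1 _)) => //.
  by rewrite e1.
rewrite laplacian0_cst laplacian0_poisson_power e1 add0r.
by rewrite -[(2 * n).+1]addn1 natrD natrM; ring.
Qed.

(** Near 0 the composition with phi_a is the integral of [K], whose x-dependence is a kernel with
    pole phi_a(z) on the sphere; its Laplacian at 0 vanishes for each z separately. *)
Lemma poisson_integral_harmonic a : B a ->
  invariant_laplacian (poisson_integral sigma phi) a = 0.
Proof.
move=> a1; rewrite invariant_laplacianE.
have a1' := a1; rewrite qballE /= in a1'.
pose K (x z : V) := (poisson_kernel (hcol a) (hcol z) * phi z) *
  poisson_kernel (hcol x) (mobius (hcol a) (hcol z)).
have sK : smooth_kernel B S K.
  apply: sk_mul; last exact: sk_poisson_mobius.
  apply: sk_param; exact: (sk_continuous_param sk_poisson_density a1).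
rewrite (@laplacian0_near_eq _ _ _ (kernel_integral sigma S K)).
  rewrite (laplacian0_kernel_integral sigma (@open_qball R n) (@compact_qsphere
    R n) sK (@qball0 R n)).
  transitivity (\int[sigma]_(z in (S : set (borelHn R n))) (0 : R)).
    apply: eq_Rintegral => z; rewrite inE qsphereE => z1.
    by apply: laplacian0_poisson_scaled; rewrite mobius_sphere.
  by rewrite Rintegral_cst ?mul0r //; exact: compact_borelHn (@compact_qsphere
    R n).
near=> x.
have x1 : B x by near: x; apply: open_nbhs_nbhs; split;
  [exact: open_qball|exact: qball0].
rewrite qballE /= in x1.
apply: eq_Rintegral => z; rewrite inE qsphereE => z1.
by rewrite hcol_rmobius poisson_kernel_mobius // /K mulrAC.
Unshelve. all: by end_near. Qed.

End Density.

(** * Total mass of the kernel and the boundary estimate *)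

Hypothesis sigmaS : is_sphere_measure sigma.
Hypothesis n_gt0 : (0 < n)%N.

Let mS : measurable (S : set (borelHn R n)).
Proof. exact: compact_borelHn (@compact_qsphere R n). Qed.

Let one_cont : {within S, continuous (fun _ : V => 1 : R)}.
Proof. by apply/continuous_subspaceT; exact: cst_continuous. Qed.

Lemma hcol_spsp1 U p x : hcol (spsp1_act U p x : V) = U *m hcol x *m p%:M.
Proof. exact: rcoordK. Qed.

Lemma continuous_spsp1 (U : 'M[quat R]_n) p : continuous (@spsp1_act R n U p).
Proof.
move=> x; apply: (@cvg_mx _ _ (nbhs x) _) => i k.
have sT : smooth_kernel [set: V] [set: V] (fun x _ => spsp1_act U p x i k).
  apply: sk_rcoord.
  apply: (@sqk_eq _ _ _ _ _ (fun x _ => (\sum_j U i j * hcol x j 0) * p)).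
    by move=> y z; rewrite mxE big_ord1 !mxE eqxx mulr1n.
  apply: sqk_mul; last exact: sqk_cst.
  by apply: sqk_sum => j; apply: sqk_mul; [exact: sqk_cst|exact: sqk_hcol].
exact: (@sk_continuous R n V [set: V] [set: V] _ x 0 sT).
Qed.

Lemma measurable_spsp1 (U : 'M[quat R]_n) p :
  measurable_fun [set: borelHn R n] (@spsp1_act R n U p : borelHn R n ->
    borelHn R n).
Proof.
apply: (@measurability _ _ (borelHn R n) (borelHn R n) setT _ open erefl).
move=> _ [A oA <-]; rewrite setTI.
apply: open_borelHn; apply: open_comp oA => x _; exact: continuous_spsp1.
Qed.

Lemma poisson_integral1_spsp1 (U : 'M[quat R]_n) p (a : V) : B a ->
  adjmx U *m U = 1%:M -> qnormsq p = 1 ->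
  poisson_integral sigma (fun=> 1) (spsp1_act U p a) =
  poisson_integral sigma (fun=> 1) a.
Proof.
move=> a1 U1 p1; have [_ sinv] := sigmaS.
set T := @spsp1_act R n U p.
have mT := measurable_spsp1 U p.
have TS : T @^-1` S = S.
  by rewrite qsphereE; apply/seteqP; split => z /=;
    rewrite hcol_spsp1 hnormsq_spsp1.
have Ta1 : B (T a).
  by move: a1; rewrite qballE /= hcol_spsp1 hnormsq_spsp1.
(* The kernel is nonnegative, so the change of variables is done for integrals in the extended
   reals. *)
suff E : (\int[sigma]_(z in (S : set (borelHn R n)))
      (poisson_kernel (hcol (T a)) (hcol z) * 1)%:E =
    \int[sigma]_(z in (S : set (borelHn R n)))
      (poisson_kernel (hcol a) (hcol z) * 1)%:E)%E.
  by rewrite /poisson_integral /Rintegral E.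
pose g (z : borelHn R n) := (poisson_kernel (hcol (T a)) (hcol (z : V)) * 1)%:E.
transitivity (\int[sigma]_(z in (T @^-1` S : set (borelHn R n))) (g \o (T :
  borelHn R n -> borelHn R n)) z)%E; last first.
  rewrite TS; apply: eq_integral => z _.
  by rewrite /g /= !hcol_spsp1 poisson_kernel_spsp1.
rewrite -(ge0_integral_pushforward mT sigma mS).
- by apply: eq_measure_integral => A mA _; apply/esym; exact: sinv.
- have := sk_continuous_param (sk_poisson_density one_cont) Ta1.
  by move=> /(integrable_continuous sigma (@compact_qsphere R n))/integrableP[].
- move=> z _; rewrite lee_fin mulr1 poisson_kernel_ge0 //.
  by move: Ta1; rewrite qballE /= => /ltW.
Qed.

Lemma poisson_integral_at0 : poisson_integral sigma (fun=> 1) 0 = 1.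
Proof.
have [sS _] := sigmaS.
transitivity (\int[sigma]_(z in (S : set (borelHn R n))) (1 : R)).
  apply: eq_Rintegral => z _; rewrite hcol0 /poisson_kernel hnormsq0 /hdot.
  rewrite (_ : (adjmx 0 *m hcol z) 0 0 = 0) ?subr0 ?qnormsq1 ?divr1 ?expr1n
    ?mulr1 //.
  by rewrite mxE big1 // => i _; rewrite !mxE qconj0 mul0r.
rewrite Rintegral_cst // mul1r -[RHS]/(fine (1%E : \bar R)); congr (fine _).
exact: sS.
Qed.

Lemma poisson_integral_one a : B a -> poisson_integral sigma (fun=> 1) a = 1.
Proof.
move=> a1; have a1' := a1; rewrite qballE /= in a1'.
rewrite -[RHS]poisson_integral_at0.
have rball b : Q b <= Q a -> B b by rewrite qballE => /le_lt_trans; exact.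
have C2 := poisson_integral_C2 one_cont.
suff h : forall b, Q b <= Q a ->
    poisson_integral sigma (fun=> 1) b = poisson_integral sigma (fun=> 1) a.
  by rewrite [RHS]h // hcol0 hnormsq0 hnormsq_ge0.
(* Comparison with a constant on the closed ball of radius |a| inside the open ball, since the
   boundary behaviour on the unit sphere is not yet available. *)
apply: (harmonic_unique n_gt0 (ltW a1') C2).
- exact: (sk_Ck (z := 0 : V) (@open_qball R n) 2 (sk_cst B [set: V] _)).
- apply: continuous_in_subspaceT => b; rewrite inE => /rball b1.
  by have [+ _] := C2; exact.
- by apply/continuous_subspaceT; exact: cst_continuous.
- by move=> b /ltW/rball b1; exact: poisson_integral_harmonic.
- by move=> b _; rewrite invariant_laplacianE laplacian0_cst.
- move=> b ba; have [U [p [U1 p1 Uab]]] := sphere_transitive (esym ba).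
  rewrite -[b]hcolK -Uab; exact: poisson_integral1_spsp1.
Qed.

(* Away from x0 the kernel is small because |1 - x^* z| >= |x - z|^2 / 2; d is a
   squared distance. *)
Lemma poisson_integral_close phi (x x0 : V) (d e M : R) :
  {within S, continuous phi} -> B x -> S x0 -> 0 < d -> 0 <= e -> 0 <= M ->
  (forall z, S z -> `|phi z| <= M) ->
  (forall z, S z -> Q (z - x0) < d -> `|phi z - phi x0| <= e) ->
  Q (x - x0) <= d / 4 -> (1 - Q x) * (64 / d ^+ 2) <= 1 ->
  `|poisson_integral sigma phi x - phi x0|
    <= e + 2 * M * ((1 - Q x) * (64 / d ^+ 2)).
Proof.
move=> phi_cont x1 Sx0 d0 e0 M0 phiM phie xd xsm.
have x1' := x1; rewrite qballE /= in x1'.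
set eta : R := (1 - Q x) * _.
have eta0 : 0 <= eta by rewrite mulr_ge0 ?divr_ge0 ?sqr_ge0 // subr_ge0 ltW.
have Me0 : 0 <= 2 * M * eta by rewrite mulr_ge0 // mulr_ge0 // ler0n.
pose P z := poisson_kernel (hcol x) (hcol (z : V)).
have cP : {within S, continuous P} := sk_continuous_param sk_poisson x1.
have ccst c : {within S, continuous (fun _ : V => c : R)}.
  by apply/continuous_subspaceT; exact: cst_continuous.
have cdiff : {within S, continuous (fun z => P z * (phi z - phi x0))}.
  by move=> z; apply: cvgM; [exact: cP|apply: cvgB;
    [exact: phi_cont|exact: ccst]].
have cP1 c : {within S, continuous (fun z => P z * c)}.
  by move=> z; apply: cvgM; [exact: cP|exact: ccst].
have cPphi : {within S, continuous (fun z => P z * phi z)}.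
  by move=> z; apply: cvgM; [exact: cP|exact: phi_cont].
have integ f (cf : {within S, continuous f}) :=
  integrable_continuous sigma (@compact_qsphere R n) cf.
have IP : \int[sigma]_(z in (S : set (borelHn R n))) (P z * 1) = 1 :=
  poisson_integral_one x1.
have P0 z : 0 <= P z by apply: poisson_kernel_ge0; exact: ltW.
have -> : poisson_integral sigma phi x - phi x0 =
    \int[sigma]_(z in (S : set (borelHn R n))) (P z * (phi z - phi x0)).
  have E : phi x0 = \int[sigma]_(z in (S : set (borelHn R n))) (P z * phi x0).
    transitivity (phi x0 * \int[sigma]_(z in (S : set (borelHn R n))) (P z *
      1)).
      by rewrite IP mulr1.
    rewrite -RintegralZl //; last exact: integ.
    by apply: eq_Rintegral => z _; rewrite mulr1 mulrC.
  rewrite {1}E /poisson_integral -(RintegralB mS (integ _ cPphi) (integ _ (cP1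
    _))).
  by apply: eq_Rintegral => z _; rewrite mulrBr.
apply: le_trans (le_normr_Rintegral mS (integ _ cdiff)) _.
(* Majorant of the integrand: e P(x, z) serves for z near x0 and integrates to e, the constant 2 M
   eta serves for the remaining z. *)
have cb : {within S, continuous (fun z => e * (P z * 1) + 2 * M * eta)}.
  move=> z; apply: cvgD; last exact: ccst.
  by apply: cvgM; [exact: ccst|exact: cP1].
apply: (@le_trans _ _ (\int[sigma]_(z in (S : set (borelHn R n))) (e * (P z *
  1) + 2 * M * eta))).
  apply: le_Rintegral => //.
  - by have /integrable_norm := integ _ cdiff.
  - exact: integ.
  move=> z Sz; rewrite normrM (ger0_norm (P0 z)) mulr1.
  have [zd|zd] := ltP (Q (z - x0)) d.
    apply: (@le_trans _ _ (e * P z)); first by rewrite mulrC ler_wpM2r // phie.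
    by rewrite lerDl.
  apply: (@le_trans _ _ (2 * M * eta)); last by rewrite lerDr mulr_ge0.
  rewrite mulrC ler_pM ?normr_ge0 //.
    by apply: le_trans (ler_normB _ _) _; rewrite mulr_natl mulr2n lerD ?phiM.
  have Qz : Q z = 1 by move: Sz; rewrite qsphereE.
  (* The parallelogram law bounds |z - x0|^2 by 2|x - z|^2 + 2|x - x0|^2, so |x - z|^2 >= (d - 2
     d/4) / 2 = d/4. *)
  have Qxz : d / 4 <= Q (x - z).
    have : Q (z - x0) <= 2 * Q (x - z) + 2 * Q (x - x0).
      rewrite !hnormsq_hcol !mulr_sumr -big_split; apply: ler_sum => i _ /=.
      rewrite !mulr_sumr -big_split; apply: ler_sum => k _ /=.
      rewrite !mxE; have := sqr_ge0 (x i k + x i k - z i k - x0 i k); nra.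
    by move: xd zd; lra.
  (* This is the origin of 64: (d/4)^2 / 4 = d^2 / 64. *)
  have Dz : (d / 4) ^+ 2 / 4 <= qnormsq (1 - hdot (hcol x) (hcol z)).
    apply: le_trans (qnormsq_1Bhdot_ge (ltW x1') _); last by rewrite Qz.
    rewrite -hcolB ler_pM2r ?invr_gt0 ?ltr0n //; apply: lerXn2r => //;
      rewrite nnegrE.
      by rewrite divr_ge0 // ltW.
    exact: hnormsq_ge0.
  have D0 : 0 < (d / 4) ^+ 2 / 4 by rewrite divr_gt0 // exprn_gt0 // divr_gt0.
  have ratio : (1 - Q x) / qnormsq (1 - hdot (hcol x) (hcol z)) <= eta.
    rewrite /eta ler_wpM2l ?subr_ge0 ?(ltW x1') //.
    rewrite (_ : 64 / d ^+ 2 = ((d / 4) ^+ 2 / 4)^-1); last by field;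
      exact: lt0r_neq0.
    by rewrite lef_pV2 ?posrE //; exact: lt_le_trans Dz.
  have r0 : 0 <= (1 - Q x) / qnormsq (1 - hdot (hcol x) (hcol z)).
    by rewrite divr_ge0 ?qnormsq_ge0 // subr_ge0 ltW.
  (* As the ratio is at most eta <= 1, its power 2n+1 is at most the ratio itself. *)
  rewrite /P /poisson_kernel exprS (le_trans _ ratio) // ler_piMr //.
  by rewrite exprn_ile1 // (le_trans ratio).
rewrite RintegralD //; last 2 first.
- by apply: integ => z; apply: cvgM; [exact: ccst|exact: cP1].
- exact: integ.
rewrite RintegralZl //; last exact: integ.
rewrite IP mulr1 lerD2l Rintegral_cst //.
by rewrite (_ : fine _ = fine (1%E : \bar R)) ?mulr1 //; congr (fine _);
  have [] := sigmaS.
Qed.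

(** * The solution of the Dirichlet problem *)

Variable phi : V -> R.
Hypothesis phi_cont : {within S, continuous phi}.

Definition poisson_extension (x : V) : R :=
  if hnorm (hcol x) < 1 then poisson_integral sigma phi x else phi x.

Lemma poisson_extension_qball x : B x -> poisson_extension x = poisson_integral
  sigma phi x.
Proof. by rewrite /poisson_extension /qball /= => ->. Qed.

Lemma poisson_extension_qsphere x : S x -> poisson_extension x = phi x.
Proof.
by rewrite qsphereE /poisson_extension hnorm_lt1 => /= ->; rewrite ltxx.
Qed.

Lemma poisson_extension_C2 : is_Ck 2 B poisson_extension.
Proof.
apply: is_Ck_eq (@open_qball R n) _ (poisson_integral_C2 phi_cont) => x x1.
by rewrite poisson_extension_qball.
Qed.

Lemma poisson_extension_harmonic a : B a -> invariant_laplacian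
  poisson_extension a = 0.
Proof.
move=> a1; rewrite -(poisson_integral_harmonic phi_cont a1)
  !invariant_laplacianE.
apply: laplacian0_near_eq; near=> x; apply: poisson_extension_qball.
apply: rmobius_qball => //; near: x.
by apply: open_nbhs_nbhs; split; [exact: open_qball|exact: qball0].
Unshelve. all: by end_near. Qed.

(** At a boundary point, nearby points of the closed ball are of two kinds: interior ones are
    controlled by [poisson_integral_close], those on the sphere by the continuity of phi. *)
Lemma poisson_extension_continuous : {within closure B,
  continuous poisson_extension}.
Proof.
rewrite closure_qball; apply/subspace_continuousP => x0 /= x01.
change (poisson_extension x @[x --> within [set x | Q x <= 1] (nbhs x0)] -->
  poisson_extension x0).
have [x0lt|x0ge] := ltP (Q x0) 1.
  have [+ _] := poisson_extension_C2.
  move=> /(_ x0); rewrite qballE => /(_ x0lt) c.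
  exact: cvg_trans (cvg_app _ (@cvg_within _ (nbhs x0) _ _)) c.
have Sx0 : S x0 by rewrite qsphereE /=; apply/eqP; rewrite eq_le x01.
rewrite poisson_extension_qsphere //.
have [M M0 phiM] : exists2 M : R, 0 <= M & forall z, S z -> `|phi z| <= M.
  have /compact_bounded[M [_ mrt]] := continuous_compact phi_cont
    (@compact_qsphere R n).
  exists (`|M| + 1) => [|z Sz]; first by rewrite addr_ge0.
  by apply: mrt; [rewrite (le_lt_trans (ler_norm M)) // ltrDl|exists z].
apply/cvgrPdist_le => e e0.
have [d d0 phid] : exists2 d : R, 0 < d & forall z, S z -> Q (z - x0) < d ->
  `|phi z - phi x0| <= e / 2.
  have /subspace_continuousP/(_ _ Sx0)/cvgrPdist_le/(_ (e / 2)) := phi_cont.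
  rewrite divr_gt0 // => /(_ isT)/nbhs_ballP[r /= r0 rP].
  (* The topology comes from the entrywise maximum norm: a squared Euclidean distance below r^2 / 4
     forces that norm to be at most r/2 < r. *)
  exists (r ^+ 2 / 4) => [|z Sz zr]; first by rewrite divr_gt0 // exprn_gt0.
  rewrite distrC; apply: rP Sz; rewrite -ball_normE /= -normrN opprB.
  apply: (@le_lt_trans _ _ (r / 2)); last by rewrite ltr_pdivrMr // ltr_pMr //
    ltr1n.
  apply: hnormsq_hcol_le; first by rewrite divr_ge0 // ltW.
  by rewrite expr_div_n (_ : 2 ^+ 2 = 4 :> R) ?ltW //; ring.
have Qc : (fun x : V => Q (x - x0)) @ x0 --> (0 : R).
  rewrite [X in _ --> X](_ : _ = Q (x0 - x0));
    last by rewrite subrr hcol0 hnormsq0.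
  have c1 : {for x0, continuous (fun x : V => x - x0)}.
    by apply: continuousB => //; exact: cst_continuous.
  exact: (continuous_comp c1 (@hnormsq_hcol_continuous R n _)).
(* Used with c = 64 / d^2 for the smallness hypothesis of [poisson_integral_close], and with 2M
   times that for its error term. *)
have Kc c : (fun x : V => (1 - Q x) * c) @ x0 --> (0 : R).
  rewrite [X in _ --> X](_ : _ = (1 - Q x0) * c); last first.
    by move: Sx0; rewrite qsphereE /= => ->; rewrite subrr mul0r.
  have c1 : {for x0, continuous (fun x : V => (1 - Q x) * c)}.
    apply: continuousM; last exact: cst_continuous.
    by apply: continuousB; [exact: cst_continuous|exact:
      hnormsq_hcol_continuous].
  exact: c1.
have nd : \forall x \near x0, Q (x - x0) <= d / 4.
  by apply: (cvgr_le _ Qc); rewrite divr_gt0.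
have n1 : \forall x \near x0, (1 - Q x) * (64 / d ^+ 2) <= 1 by apply: (cvgr_le
  _ (Kc _)).
have n2 : \forall x \near x0, (1 - Q x) * (64 / d ^+ 2 * (2 * M)) <= e / 2.
  by apply: (cvgr_le _ (Kc _)); rewrite divr_gt0.
near=> x.
have xd : Q (x - x0) <= d / 4 by near: x; exact: cvg_within nd.
have x1 : (1 - Q x) * (64 / d ^+ 2) <= 1 by near: x; exact: cvg_within n1.
have x2 : (1 - Q x) * (64 / d ^+ 2 * (2 * M)) <= e / 2 by near: x;
  exact: cvg_within n2.
have xc : Q x <= 1 by near: x; exact: withinT.
rewrite distrC; have [xlt|xge] := ltP (Q x) 1.
  have Bx : B x by rewrite qballE.
  rewrite poisson_extension_qball //.
  apply: le_trans (poisson_integral_close phi_cont Bx Sx0 d0 _ M0 phiM phid xd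
    x1) _.
    by rewrite divr_ge0 // ltW.
  by move: x2; lra.
have Sx : S x by rewrite qsphereE /=; apply/eqP; rewrite eq_le xc.
rewrite poisson_extension_qsphere // (le_trans (phid _ Sx _)) //.
  by rewrite (le_lt_trans xd) // ltr_pdivrMr // ltr_pMr // ltr1n.
by rewrite ler_pdivrMr // ler_pMr // ler1n.
Unshelve. all: by end_near. Qed.

End PoissonIntegral.

Theorem theorem1p2 (R : realType) (n : nat) (n_gt0 : (0 < n)%N)
    (sigma : probability (borelHn R n) R) (sigmaS : is_sphere_measure sigma)
    (phi : realHn R n -> R) (phi_cont : {within qsphere R n, continuous phi}) :
  exists u : realHn R n -> R,
    [/\ dirichlet_solution phi u,
        forall v : realHn R n -> R, dirichlet_solution phi v ->
          forall q, closure (qball R n) q -> v q = u q &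
        forall a, qball R n a -> u a = poisson_integral sigma phi a].
Proof.
have C2 := poisson_extension_C2 sigma phi_cont.
have cont := poisson_extension_continuous sigmaS n_gt0 phi_cont.
have harm := poisson_extension_harmonic sigma phi_cont.
exists (poisson_extension sigma phi); split.
- by split=> // z; exact: poisson_extension_qsphere.
- move=> v [vC2 vcont vharm vS]; rewrite closure_qball in cont vcont *.
  apply: (harmonic_unique n_gt0 (lexx 1)) => //.
  + by move=> a a1; apply: vharm; rewrite qballE.
  + by move=> a a1; apply: harm; rewrite qballE.
  + by move=> a a1; rewrite vS ?poisson_extension_qsphere // qsphereE.
- by move=> a; exact: poisson_extension_qball.
Qed.
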